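(* Let $G$ be an infinite connected simple graph with bounded degrees that is uniformly weakly recurrent, and let $x\in V(G)$. Then for the simple random walk on $G$ started at $x$ the following hold. (i) $$\limsup_{n\to\infty}\frac{R_n}{n/\log n}\le r_{\sup},\quad P^x\text{-a.s.}$$ (ii) For every $\epsilon>0$, $$\lim_{n\to\infty}P^x\left(\frac{R_n}{n/\log n}\le r_{\inf}-\epsilon\right)=0.$$ (iii) $$\liminf_{n\to\infty}\frac{R_n}{n/\log n}\ge\frac{r_{\inf}}{2},\quad P^x\text{-a.s.}$$ (iv) $$r_{\inf}\le\liminf_{n\to\infty}\frac{E^x[R_n]}{n/\log n}\le\limsup_{n\to\infty}\frac{E^x[R_n]}{n/\log n}\le r_{\sup}.$$
   Context: The simple random walk $(S_n)_{n\ge 0}$ on $G$ under $P^x$ is the Markov chain with $P^x(S_0=x)=1$ that at each step moves from its current vertex $z$ to each neighbour of $z$ with probability $1/\deg(z)$; $E^x$ is the expectation under $P^x$, and $p_n(x,y)=P^x(S_n=y)$. The range is $R_n=|\{S_0,\dots,S_n\}|$. Set $T_x=\inf\{k\ge 1: S_k=x\}$. $G$ is uniformly weakly recurrent if there exist positive constants $c,C$ such that for every $n\ge 1$ and every $x\in V(G)$, $c\le n\,(p_n(x,x)+p_{n+1}(x,x))\le C$. Define $$r_{\inf}=\liminf_{n\to\infty}(\log n)\inf_{x\in V(G)}P^x(T_x>n),\qquad r_{\sup}=\limsup_{n\to\infty}(\log n)\sup_{x\in V(G)}P^x(T_x>n).$$ *)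

(* Defs.v *)
From HB Require Import structures.
From mathcomp Require Import all_boot all_order all_algebra finmap.
From mathcomp Require Import all_classical all_reals all_analysis.
Set Implicit Arguments.
Unset Strict Implicit.
Unset Printing Implicit Defensive.
Import Order.TTheory GRing.Theory Num.Theory.
Import numFieldNormedType.Exports.
Local Open Scope classical_set_scope.
Local Open Scope ring_scope.

Section Graph.
Context (V : choiceType) (e : rel V).

Definition simple_graph := symmetric e /\ irreflexive e.

Definition nbrs (v : V) : set V := [set u | e v u].

Definition bounded_degree := exists D : nat, forall v, (nbrs v #<= `I_D)%card.

Definition connected_graph :=
  forall u v : V, exists p : seq V, path e u p /\ last u p = v.

(* [fset_set] sends infinite sets to the empty one: [deg] is meaningful for
   locally finite graphs only. *)
Definition deg (v : V) : nat := #|` fset_set (nbrs v)|.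

End Graph.

Section Walk.
Context (R : realType) (V : choiceType) (e : rel V).
Context (d : measure_display) (Omega : measurableType d).
Context (P : V -> probability Omega R) (S : nat -> Omega -> V).

Definition step (z y : V) : R := if e z y then (deg e z)%:R^-1 else 0.

(* The state space is countable (a connected locally finite graph), so the
   measurability of the fibres is that of [S n] for the discrete sigma-algebra
   on [V], and the Markov property can be stated on finite trajectories
   [z 0, ..., z n.+1]. *)
Definition simple_random_walk :=
  [/\ forall n y, measurable [set w | S n w = y],
      forall x, P x [set w | S 0%N w = x] = 1%E &
      forall x n (z : nat -> V),
        P x [set w | forall k, (k <= n.+1)%N -> S k w = z k] =
        (P x [set w | forall k, (k <= n)%N -> S k w = z k] *
         (step (z n) (z n.+1))%:E)%E].

Definition heat_kernel (n : nat) (x y : V) : R :=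
  fine (P x [set w | S n w = y]).

Definition walk_range (n : nat) (w : Omega) : nat :=
  size (undup [seq S k w | k <- iota 0 n.+1]).

(* [+oo] when the walk never visits [x] at a positive time. *)
Definition hitting_time (x : V) (w : Omega) : \bar R :=
  ereal_inf [set (k%:R)%:E | k in [set k : nat | (1 <= k)%N /\ S k w = x]].

Definition uniformly_weakly_recurrent :=
  exists c C : R, [/\ 0 < c, 0 < C &
    forall (n : nat) (x : V), (1 <= n)%N ->
      c <= n%:R * (heat_kernel n x x + heat_kernel n.+1 x x) <= C].

Definition escape_prob (n : nat) (x : V) : \bar R :=
  P x [set w | ((n%:R)%:E < hitting_time x w)%E].

Definition r_inf : \bar R :=
  limn_einf (fun n => (ln n%:R)%:E * ereal_inf (range (escape_prob n)))%E.

Definition r_sup : \bar R :=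
  limn_esup (fun n => (ln n%:R)%:E * ereal_sup (range (escape_prob n)))%E.

Definition scale (n : nat) : R := n%:R / ln n%:R.

End Walk.

(* Main.v *)
Require Import Defs.
From HB Require Import structures.
From mathcomp Require Import all_boot all_order all_algebra finmap.
From mathcomp Require Import all_classical all_reals all_analysis.
From mathcomp Require Import measurable_realfun.
From mathcomp Require Import ring lra zify.
Import Order.TTheory GRing.Theory Num.Theory.
Import numFieldNormedType.Exports.
Local Open Scope classical_set_scope.
Local Open Scope ring_scope.

(** The argument works with functionals of finite paths.  The walk stopped at
    time [n] follows one of finitely many paths, so that the expectation of a
    functional of [S_0, ..., S_n] is a finite sum, [path_mean], defined by
    recursion on [n] as an iterated average over neighbours; the Markov property
    is [path_mean_cat], and [integral_trajectory] identifies [path_mean] with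
    the integral under [P x].

    The mean of the range.  Counting each site at its last visit, the range is
    the number of times [i <= n] such that [S_i] is not revisited in
    [i + 1, n].  Hence its mean is a sum of [n + 1] means of escape
    probabilities, at least [n + 1] times the infimum of the probabilities
    [P^y(T_y > n)] and at most [a + (n + 1) sup_y P^y(T_y > a)] for every [a].
    Taking [a] close to [n] on the logarithmic scale gives the bounds on the
    mean.

    The upper tail ([range_upper_le]).  Cut the path into [K], about
    [(ln n)^4], blocks.  The range is at most the sum of the ranges of the
    blocks, and the exponential moment of this sum, at scale the inverse of the
    length of a block, is at most the product of the moments of the blocks,
    uniformly in their starting points.  This gives a tail in
    [exp (- c (ln n)^3)], summable in [n], and the upper bound follows from the
    Borel-Cantelli lemma.

    The lower tail ([range_lower_le]).  The number of sites counted at their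
    last visit within their own block, at least [2a] steps before its end, has
    an exponentially small lower tail for the same reason.  It exceeds the range
    by at most the number of late returns, that is of times whose site is not
    revisited within [2a] steps, where [a] is about [n / (ln n)^8], but is
    revisited before time [n].  By reversibility the on-diagonal bound extends
    to [p_n(x, y) <= C / n] ([kernel_le]); together with the lower bound of the
    Green function by [c ln n] this bounds the probability of a late return by a
    constant times [(1 + ln (n / a)) / (ln n)^2] ([late_return],
    [late_return_le]).  By the Markov inequality the lower tail is at most a
    constant times [(ln n)^(- 3 / 4)], which gives the convergence in
    probability.

    The factor [1 / 2].  This bound is not summable along a geometric sequence
    of times, but its square is.  If the range at time [n] is at most half of
    [r n / ln n], with [r] less than [r_inf], then both halves of the path have
    a small range, which has probability at most the square of the lower tail at
    time [n / 2] ([range_halves]).  The Borel-Cantelli lemma along the integer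
    parts of [exp (delta k)], and monotonicity of the range in between, give the
    almost sure lower bound. *)

Set Implicit Arguments.
Unset Strict Implicit.
Unset Printing Implicit Defensive.

(** * Means over finite paths *)

Section PathMean.
Context (R : realType) (V : choiceType) (N : V -> seq V).
Implicit Types (x y z : V) (p q s : seq V) (f g : seq V -> R) (h : V -> R).

(** The average of [h] over the neighbours of [x], listed by [N x]. *)
Definition nbr_mean h x : R := (size (N x))%:R^-1 * \sum_(z <- N x) h z.

(** The expectation of [f (S_1, ..., S_n)] for the walk started at [x]; the
    starting point is not part of the path. *)
Fixpoint path_mean (n : nat) (x : V) f : R :=
  if n is m.+1 then nbr_mean (fun z => path_mean m z (fun p => f (z :: p))) x
  else f [::].

Definition nbr : rel V := fun u v => v \in N u.

Lemma nbr_mean_le h1 h2 x :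
  (forall z, z \in N x -> h1 z <= h2 z) -> nbr_mean h1 x <= nbr_mean h2 x.
Proof.
move=> le_h; apply: ler_wpM2l; first by rewrite invr_ge0.
by rewrite big_seq [leRHS]big_seq; apply: ler_sum.
Qed.

Lemma nbr_meanZ a h x : nbr_mean (fun z => a * h z) x = a * nbr_mean h x.
Proof. by rewrite /nbr_mean -mulr_sumr mulrCA. Qed.

Lemma nbr_meanD h1 h2 x :
  nbr_mean (fun z => h1 z + h2 z) x = nbr_mean h1 x + nbr_mean h2 x.
Proof. by rewrite /nbr_mean big_split mulrDr. Qed.

Lemma nbr_mean_sum (I : Type) (r : seq I) (F : I -> V -> R) x :
  nbr_mean (fun z => \sum_(i <- r) F i z) x = \sum_(i <- r) nbr_mean (F i) x.
Proof. by rewrite /nbr_mean exchange_big mulr_sumr. Qed.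

Lemma path_mean_le n x f g :
  (forall p, size p = n -> path nbr x p -> f p <= g p) ->
  path_mean n x f <= path_mean n x g.
Proof.
elim: n x f g => [|n IH] x f g le_fg /=; first exact: le_fg.
apply: nbr_mean_le => z xz; apply: IH => p sp zp; apply: le_fg => /=.
  by rewrite sp.
by rewrite zp andbT.
Qed.

Lemma path_mean_eq n x f g :
  (forall p, size p = n -> path nbr x p -> f p = g p) ->
  path_mean n x f = path_mean n x g.
Proof.
move=> eq_fg; apply/eqP; rewrite eq_le.
by apply/andP; split; apply: path_mean_le => p sp xp; rewrite eq_fg.
Qed.

Lemma path_meanZ n x a f :
  path_mean n x (fun p => a * f p) = a * path_mean n x f.
Proof.
elim: n x f => [//|n IH] x f /=; rewrite -nbr_meanZ.
by congr (_ * _); apply: eq_bigr => z _; rewrite IH.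
Qed.

Lemma path_meanD n x f g :
  path_mean n x (fun p => f p + g p) = path_mean n x f + path_mean n x g.
Proof.
elim: n x f g => [//|n IH] x f g /=; rewrite -nbr_meanD.
by congr (_ * _); apply: eq_bigr => z _; rewrite IH.
Qed.

Lemma path_mean_sum (I : Type) (r : seq I) (F : I -> seq V -> R) n x :
  path_mean n x (fun p => \sum_(i <- r) F i p)
  = \sum_(i <- r) path_mean n x (F i).
Proof.
elim: n x F => [//|n IH] x F /=; rewrite -nbr_mean_sum.
by congr (_ * _); apply: eq_bigr => z _; rewrite IH.
Qed.

(** The Markov property. *)
Lemma path_mean_cat n m x f :
  path_mean (n + m) x f
  = path_mean n x (fun p => path_mean m (last x p) (fun q => f (p ++ q))).
Proof.
elim: n x f => [//|n IH] x f /=; congr (_ * _); apply: eq_bigr => z _.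
by rewrite IH.
Qed.

(** The neighbour-to-neighbour paths of length [n] issued from [x]. *)
Fixpoint npaths (n : nat) (x : V) : seq (seq V) :=
  if n is m.+1 then flatten [seq map (cons z) (npaths m z) | z <- N x]
  else [:: [::]].

(** The probability that the walk started at [x] follows [p]. *)
Fixpoint path_weight (x : V) (p : seq V) : R :=
  if p is z :: p' then
    (if z \in N x then (size (N x))%:R^-1 else 0) * path_weight z p'
  else 1.

Lemma path_mean_npaths n x f :
  path_mean n x f = \sum_(p <- npaths n x) path_weight x p * f p.
Proof.
elim: n x f => [|n IH] x f /=; first by rewrite big_seq1 mul1r.
rewrite big_flatten /= big_map /nbr_mean mulr_sumr big_seq [RHS]big_seq.
apply: eq_bigr => z xz; rewrite IH big_map mulr_sumr.
by apply: eq_bigr => p _ /=; rewrite xz mulrA.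
Qed.

Lemma npathsP n x p : (p \in npaths n x) = (size p == n) && path nbr x p.
Proof.
elim: n x p => [|n IH] x p /=; first by rewrite inE; case: p.
apply/flatten_mapP/andP => [[z xz /mapP[q]]|[]].
  by rewrite IH => /andP[/eqP sq zq] -> /=; rewrite sq eqxx zq andbT.
case: p => [//|z p] /=; rewrite eqSS => sp /andP[xz zp].
by exists z => //; apply/mapP; exists p; rewrite // IH sp.
Qed.

Lemma npaths_uniq n x : (forall y, uniq (N y)) -> uniq (npaths n x).
Proof.
move=> uN; elim: n x => [//|n IH] x /=.
apply: allpairs_uniq_dep => [|z _|[z p] [w q] _ _ /= [-> ->]] //.
Qed.

(** From here on every vertex has a neighbour, so that [path_mean] is a mean. *)
Context (N_gt0 : forall x, (0 < size (N x))%N).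

Lemma nbr_mean_cst a x : nbr_mean (fun=> a) x = a.
Proof.
rewrite /nbr_mean big_const_seq count_predT iter_addr_0 -[a *+ _]mulr_natl.
by rewrite mulKf// pnatr_eq0 -lt0n.
Qed.

Lemma path_mean_cst n x a : path_mean n x (fun=> a) = a.
Proof.
elim: n x => [//|n IH] x /=; under [X in nbr_mean X]funext do rewrite IH.
exact: nbr_mean_cst.
Qed.

Lemma path_mean_ge0 n x f :
  (forall p, size p = n -> path nbr x p -> 0 <= f p) -> 0 <= path_mean n x f.
Proof.
by move=> f0; rewrite -(path_mean_cst n x 0); apply: path_mean_le.
Qed.

Lemma path_mean_take n m x f :
  path_mean (n + m) x (fun p => f (take n p)) = path_mean n x f.
Proof.
rewrite path_mean_cat; apply: path_mean_eq => p sp _.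
rewrite -[RHS](path_mean_cst m (last x p)); apply: path_mean_eq => q _ _.
by rewrite take_size_cat.
Qed.

(** [kernel n x y] is [p_n(x, y)]. *)
Definition kernel n x y : R := path_mean n x (fun p => (last x p == y)%:R).

(** [escape n x] is [P^x(T_x > n)]. *)
Definition escape n x : R := path_mean n x (fun p => (x \notin p)%:R).

(** [hit n x y] is the probability of visiting [y] during [0, n]. *)
Definition hit n x y : R := path_mean n x (fun p => (y \in x :: p)%:R).

Lemma kernel0 x y : kernel 0 x y = (x == y)%:R.
Proof. by []. Qed.

Lemma kernelS n x y : kernel n.+1 x y = nbr_mean (fun z => kernel n z y) x.
Proof. by []. Qed.

Lemma kernelD n m x y :
  kernel (n + m) x y = path_mean n x (fun p => kernel m (last x p) y).
Proof.
rewrite /kernel path_mean_cat; apply: path_mean_eq => p _ _.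
by apply: path_mean_eq => q _ _; rewrite last_cat.
Qed.

Lemma kernel_ge0 n x y : 0 <= kernel n x y.
Proof. by apply: path_mean_ge0 => p _ _; rewrite ler0n. Qed.

(** The law of the end point, summed over any finite set [B] that contains the
    points reachable in [n] steps. *)
Lemma path_mean_last n x h (B : seq V) : uniq B ->
  {subset [seq last x p | p <- npaths n x] <= B} ->
  path_mean n x (fun p => h (last x p)) = \sum_(w <- B) kernel n x w * h w.
Proof.
move=> uB sB.
transitivity (path_mean n x (fun p => \sum_(w <- B) h w * (last x p == w)%:R)).
  apply: path_mean_eq => p sp xp.
  have lB : last x p \in B.
    by apply/sB/map_f; rewrite npathsP sp eqxx.
  rewrite (bigD1_seq (last x p))//= eqxx mulr1 big1 ?addr0// => w.
  by rewrite eq_sym => /negbTE ->; rewrite mulr0.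
rewrite path_mean_sum; apply: eq_bigr => w _; rewrite path_meanZ mulrC.
by [].
Qed.

Lemma escape_ge0 n x : 0 <= escape n x.
Proof. by apply: path_mean_ge0 => p _ _; rewrite ler0n. Qed.

Lemma escape_le1 n x : escape n x <= 1.
Proof.
rewrite -(path_mean_cst n x 1).
by apply: path_mean_le => p _ _; rewrite lern1 leq_b1.
Qed.

Lemma escape_le n m x : (n <= m)%N -> escape m x <= escape n x.
Proof.
move=> /subnKC <-; rewrite {2}/escape -(path_mean_take n (m - n)).
apply: path_mean_le => p _ _; rewrite ler_nat.
case: (boolP (x \in p)) => [//|xp]; case: (boolP (x \in take _ _)) => [|//].
by move=> /mem_take; rewrite (negbTE xp).
Qed.

Lemma hit0 x y : hit 0 x y = (x == y)%:R.
Proof. by rewrite /hit /= inE eq_sym. Qed.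

Lemma hitS n x y :
  hit n.+1 x y = if x == y then 1 else nbr_mean (fun z => hit n z y) x.
Proof.
case: eqVneq => [->|xy].
  rewrite -(path_mean_cst n.+1 y 1); apply: path_mean_eq => p _ _.
  by rewrite inE eqxx.
rewrite /hit /=; congr (_ * _); apply: eq_bigr => z _.
by apply: path_mean_eq => p _ _; rewrite inE eq_sym (negbTE xy).
Qed.

Lemma escapeS n x : escape n.+1 x = 1 - nbr_mean (fun z => hit n z x) x.
Proof.
apply/eqP; rewrite eq_sym subr_eq /escape /= -nbr_meanD -[X in X == _](nbr_mean_cst _ x).
apply/eqP; congr (_ * _); apply: eq_bigr => z _.
rewrite /hit -path_meanD -[LHS](path_mean_cst n z 1).
by apply: path_mean_eq => p _ _; case: (x \in z :: p); rewrite ?addr0 ?add0r.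
Qed.

(** Decomposition of the visits to [y] at the last visit before time [n]. *)
Lemma last_visit n z y :
  \sum_(k < n.+1) kernel k z y * escape (n - k) y = hit n z y.
Proof.
elim: n z => [|n IH] z.
  by rewrite big_ord1 kernel0 hit0 /escape /= mulr1.
rewrite big_ord_recl kernel0 subn0 hitS.
rewrite (eq_bigr (fun k : 'I_n.+1 =>
  nbr_mean (fun w => escape (n - k) y * kernel k w y) z)); last first.
  by move=> k _; rewrite lift0 subSS kernelS mulrC -nbr_meanZ.
rewrite -nbr_mean_sum.
have -> : (fun w => \sum_(k < n.+1) escape (n - k) y * kernel k w y)
          = (fun w => hit n w y).
  by apply/funext => w; rewrite -IH; apply: eq_bigr => k _; rewrite mulrC.
case: eqVneq => [->|zy]; last by rewrite mul0r add0r.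
by rewrite mul1r escapeS subrK.
Qed.

(** The expected number of visits to [y] during [0, n], starting from [y]. *)
Definition green n y : R := \sum_(k < n.+1) kernel k y y.

Lemma green_ge0 n y : 0 <= green n y.
Proof. by apply: sumr_ge0 => k _; apply: kernel_ge0. Qed.

(** In the decomposition at the last visit to [y], starting from [y], each
    escape probability is at least [escape n y]. *)
Lemma escape_green n y : escape n y * green n y <= 1.
Proof.
have -> : 1 = hit n y y.
  rewrite -(path_mean_cst n y 1); apply: path_mean_eq => p _ _.
  by rewrite inE eqxx.
rewrite -last_visit mulr_sumr; apply: ler_sum => k _.
by rewrite mulrC ler_wpM2l ?kernel_ge0 ?escape_le ?leq_subr.
Qed.

(** After hitting [y], the walk makes [green j y] visits to [y] on average
    during the next [j] steps. *)
Lemma hit_green n j w y :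
  hit n w y * green j y <= \sum_(k < (n + j).+1) kernel k w y.
Proof.
have green_sum m : (j <= m)%N -> green j y <= \sum_(k < m.+1) kernel k y y.
  move=> jm; rewrite /green -!(big_mkord xpredT (fun k => kernel k y y)).
  rewrite (@big_cat_nat _ _ _ j.+1 0 m.+1)//= lerDl.
  by apply: sumr_ge0 => k _; apply: kernel_ge0.
elim: n w => [|n IH] w.
  rewrite hit0; case: eqVneq => [->|_]; first by rewrite mul1r green_sum.
  by rewrite mul0r; apply: sumr_ge0 => k _; apply: kernel_ge0.
rewrite hitS; case: eqVneq => [->|wy]; first by rewrite mul1r green_sum// leq_addl.
rewrite mulrC -nbr_meanZ addSn big_ord_recl; apply: ler_wpDl.
  exact: kernel_ge0.
rewrite [leRHS](eq_bigr (fun k : 'I_(n + j).+1 =>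
  nbr_mean (fun z => kernel k z y) w)); last by move=> k _; rewrite lift0.
by rewrite -nbr_mean_sum; apply: nbr_mean_le => z _; rewrite mulrC.
Qed.

(** A return after time [2a]: the walk escapes for [a] steps, then hits [x]
    after another [a] steps. *)
Lemma late_return n a j x (C : R) :
  (forall k z, (0 < k)%N -> kernel k z x <= C / k%:R) -> (0 < a)%N -> 0 <= C ->
  path_mean n x (fun p => ((x \notin take (a + a) p) && (x \in p))%:R)
    * green j x <= escape a x * (C * \sum_(k < (n + j).+1) (a + k)%:R^-1).
Proof.
move=> kC a0 C0.
have S0 m : 0 <= C * \sum_(k < m) (a + k)%:R^-1.
  by apply: mulr_ge0 => //; apply: sumr_ge0 => k _; rewrite invr_ge0.
have [na|] := ltnP n (a + a).
  rewrite (_ : path_mean _ _ _ = 0).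
    by rewrite mul0r; apply: mulr_ge0 => //; exact: escape_ge0.
  rewrite -(path_mean_cst n x 0); apply: path_mean_eq => p sp _.
  by rewrite take_oversize ?andNb// sp ltnW.
move=> /subnKC; move: (n - _)%N => m nE.
have late z : path_mean (a + m) z (fun q => (x \in drop a q)%:R) * green j x
    <= C * \sum_(k < (n + j).+1) (a + k)%:R^-1.
  apply: (@le_trans _ _
      (path_mean a z (fun p => hit m (last z p) x * green j x))).
    under [X in _ <= path_mean _ _ X]funext do rewrite mulrC.
    rewrite path_meanZ mulrC ler_wpM2l ?green_ge0// path_mean_cat.
    apply: path_mean_le => p sp _; apply: path_mean_le => q _ _.
    rewrite drop_size_cat// ler_nat inE.
    by case: (x \in q); rewrite ?orbT.
  apply: (@le_trans _ _ (path_mean a z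
      (fun p => \sum_(k < (m + j).+1) kernel k (last z p) x))).
    by apply: path_mean_le => p _ _; apply: hit_green.
  rewrite path_mean_sum.
  have -> : ((n + j).+1 = (m + j).+1 + (a + a))%N by lia.
  rewrite big_split_ord /= mulrDr; apply: ler_wpDr.
    by apply: mulr_ge0 => //; apply: sumr_ge0 => k _; rewrite invr_ge0.
  rewrite mulr_sumr; apply: ler_sum => k _.
  by rewrite -kernelD; apply: kC; rewrite addn_gt0 a0.
rewrite -{1}nE -addnA path_mean_cat.
apply: (@le_trans _ _ (path_mean a x (fun p =>
   (C * \sum_(k < (n + j).+1) (a + k)%:R^-1) * (x \notin p)%:R)));
  last by rewrite path_meanZ [leLHS]mulrC.
rewrite [leLHS]mulrC -path_meanZ; apply: path_mean_le => p sp _.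
case: (boolP (x \in p)) => xp.
  rewrite mulr0 (_ : path_mean _ _ _ = 0) ?mulr0//.
  rewrite -(path_mean_cst (a + m) (last x p) 0).
  apply: path_mean_eq => q _ _; rewrite take_cat sp ltnNge leq_addr /=.
  by rewrite mem_cat xp.
rewrite mulr1 [leLHS]mulrC; apply: le_trans (late (last x p)).
apply: ler_wpM2r; first exact: green_ge0.
apply: path_mean_le => q _ _; rewrite take_cat sp ltnNge leq_addr /= addKn.
rewrite !mem_cat (negbTE xp) /= ler_nat -{2}(cat_take_drop a q) mem_cat.
by case: (x \in take a q).
Qed.

Context (N_uniq : forall x, uniq (N x)).
Context (N_sym : forall x y, (y \in N x) = (x \in N y)).

Lemma kernel1 x y : kernel 1 x y = if y \in N x then (size (N x))%:R^-1 else 0.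
Proof.
rewrite kernelS /nbr_mean; under eq_bigr do rewrite kernel0.
case: ifPn => xy.
  rewrite (bigD1_seq y)//= eqxx big1 ?addr0 ?mulr1// => w.
  by move=> /negbTE ->.
rewrite big_seq big1 ?mulr0// => z xz; case: eqVneq => // zy.
by rewrite -zy xz in xy.
Qed.

(** The walk is reversible with respect to the degree. *)
Lemma kernel_sym n x y :
  (size (N x))%:R * kernel n x y = (size (N y))%:R * kernel n y x.
Proof.
elim: n x y => [|n IH] x y.
  by rewrite !kernel0 eq_sym; case: eqVneq => [->|_]; rewrite ?mulr0.
pose B := undup ([seq last x p | p <- npaths n x] ++ N y).
rewrite -addn1 kernelD (@path_mean_last n x (fun w => kernel 1 w y) B);
  last 2 first.
- exact: undup_uniq.
- by move=> w wB; rewrite mem_undup mem_cat wB.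
rewrite addn1 kernelS /nbr_mean mulVKf ?pnatr_eq0 -?lt0n// mulr_sumr.
transitivity (\sum_(w <- B | w \in N y) kernel n w x).
  rewrite [RHS]big_mkcond; apply: eq_bigr => w _.
  rewrite mulrA IH kernel1 N_sym; case: ifP => _; last by rewrite mulr0.
  by rewrite mulrC mulKf// pnatr_eq0 -lt0n.
rewrite -big_filter; apply/perm_big/uniq_perm => //.
  by rewrite filter_uniq// undup_uniq.
by move=> w; rewrite mem_filter mem_undup mem_cat; case: (w \in N y); rewrite ?orbT.
Qed.

Context (D : nat) (N_le : forall x, (size (N x) <= D)%N).

(** By the inequality [2 a b <= a ^ 2 + b ^ 2] in the sum over the middle point,
    and reversibility at the cost of a factor [D]. *)
Lemma kernel_double n z y : kernel (n + n) z y <=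
  D%:R / 2 * (kernel (n + n) z z + kernel (n + n) y y).
Proof.
pose B := undup ([seq last z p | p <- npaths n z]
                 ++ [seq last y p | p <- npaths n y]).
have uB : uniq B by exact: undup_uniq.
have zB : {subset [seq last z p | p <- npaths n z] <= B}.
  by move=> w wB; rewrite mem_undup mem_cat wB.
have yB : {subset [seq last y p | p <- npaths n y] <= B}.
  by move=> w wB; rewrite mem_undup mem_cat wB orbT.
rewrite !kernelD (@path_mean_last n z (fun w => kernel n w y) B)//.
rewrite (@path_mean_last n z (fun w => kernel n w z) B)//.
rewrite (@path_mean_last n y (fun w => kernel n w y) B)//.
rewrite -big_split mulr_sumr /=; apply: ler_sum => w _.
have := kernel_sym n z w; have := kernel_sym n y w.
have d1 v : 1 <= (size (N v))%:R :> R by rewrite ler1n.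
have dD v : (size (N v))%:R <= D%:R :> R by rewrite ler_nat.
have := d1 z; have := dD z; have := d1 y; have := dD y.
have := d1 w; have := dD w; have := kernel_ge0 n z w; have := kernel_ge0 n w z.
have := kernel_ge0 n y w; have := kernel_ge0 n w y.
move: (kernel n z w) (kernel n w z) (kernel n y w) (kernel n w y).
move: (size _)%:R (size (N y))%:R (size (N z))%:R (D%:R : R).
move=> dw dy dz d zw wz yw wy wy0 yw0 wz0 zw0 dwd dw1 dyd dy1 dzd dz1 Ey Ez.
have h1 : zw <= d * wz.
  have : dz * zw <= d * wz by rewrite Ez ler_wpM2r.
  by apply: le_trans; rewrite ler_peMl.
have h2 : wy <= d * yw.
  have : dw * wy <= d * yw by rewrite -Ey ler_wpM2r.
  by apply: le_trans; rewrite ler_peMl.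
have h3 : zw * zw <= d * (zw * wz) by rewrite mulrCA ler_wpM2l.
have h4 : wy * wy <= d * (yw * wy) by rewrite mulrA ler_wpM2r.
have h5 : 0 <= (zw - wy) ^+ 2 by exact: sqr_ge0.
by nra.
Qed.

(** The on-diagonal decay of the kernel in [1/n] extends off the diagonal. *)
Lemma kernel_le (C : R) :
  (forall n x, (1 <= n)%N ->
     n%:R * (kernel n x x + kernel n.+1 x x) <= C) ->
  forall n z y, (0 < n)%N -> kernel n z y <= (2 * D%:R * C + 1) / n%:R.
Proof.
move=> diag n z y n0.
have C0 : 0 <= C.
  apply: le_trans (diag 1%N z isT).
  by rewrite mul1r addr_ge0// kernel_ge0.
have diag' m v : (0 < m)%N -> kernel (m + m) v v <= C / (m + m)%:R.
  move=> m0; have mm0 : (0 < m + m)%N by rewrite addn_gt0 m0.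
  rewrite ler_pdivlMr ?ltr0n// mulrC; apply: le_trans (diag _ v mm0).
  by rewrite ler_wpM2l// lerDl kernel_ge0.
have dbl m v w : (0 < m)%N -> kernel (m + m) v w <= D%:R * C / (m + m)%:R.
  move=> m0; apply: le_trans (kernel_double m v w) _.
  have := diag' m v m0; have := diag' m w m0; rewrite -[D%:R * C / _]mulrA.
  move: (C / _) (kernel _ _ _) (kernel _ w w) => c k1 k2 h2 h1.
  by have := ler0n R D; move: (D%:R : R) => dd dd0; nra.
rewrite ler_pdivlMr ?ltr0n//.
have DC0 : 0 <= D%:R * C by rewrite mulr_ge0.
have [|n1] := leqP n 1.
  case: n n0 => [//|[|//]] _ _; rewrite mulr1.
  apply: (@le_trans _ _ 1); last by rewrite -mulrA; lra.
  rewrite -(path_mean_cst 1 z 1); apply: path_mean_le => p _ _.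
  by rewrite lern1 leq_b1.
have h0 : (0 < n./2)%N by lia.
have := odd_double_half n; rewrite -addnn; move: n./2 h0 => h h0.
case: (odd n) => /= nE; last first.
  rewrite -nE add0n; have := dbl _ z y h0.
  rewrite ler_pdivlMr ?ltr0n ?addn_gt0 ?h0// => /le_trans -> //.
  by rewrite -mulrA; lra.
have : kernel n z y <= D%:R * C / (h + h)%:R.
  rewrite -nE add1n kernelS -[leRHS](nbr_mean_cst _ z).
  by apply: nbr_mean_le => w _; exact: dbl.
rewrite ler_pdivlMr ?ltr0n ?addn_gt0 ?h0// => le1.
have -> : n%:R = 1 + (h + h)%:R :> R by rewrite -nE natrD.
have : 1 <= (h + h)%:R :> R by rewrite ler1n addn_gt0 h0.
have := kernel_ge0 n z y.
move: (kernel n z y) (_ + _)%:R le1 => k m le1 k0 m1; rewrite -mulrA.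
by nra.
Qed.

End PathMean.

(** * Counting functionals of a path *)

Section PathCounts.
Context (V : choiceType).
Implicit Types (x y z : V) (p q s : seq V).

(** The number of positions of [s] whose point [z], together with the part of
    [s] that follows, satisfies [phi]. *)
Fixpoint tally (phi : V -> seq V -> bool) s : nat :=
  if s is z :: s' then (phi z s' + tally phi s')%N else 0%N.

(** Counting points at their last visit. *)
Definition range_size : seq V -> nat := tally (fun z s => z \notin s).

(** Points not revisited in [s] and seen at least [g] steps before its end. *)
Definition early_last g : seq V -> nat :=
  tally (fun z s => (g <= size s)%N && (z \notin s)).

(** Points whose next visit exists and comes after more than [g] steps. *)
Definition late_returns g : seq V -> nat :=
  tally (fun z s => (z \notin take g s) && (z \in s)).

Lemma size_undup_range s : size (undup s) = range_size s.
Proof.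
by elim: s => //= z s IH; rewrite /range_size /= -/(range_size s) -IH; case: ifP.
Qed.

Lemma range_size_le s1 s2 :
  {subset s1 <= s2} -> (range_size s1 <= range_size s2)%N.
Proof.
move=> s12; rewrite -!size_undup_range; apply: uniq_leq_size.
  exact: undup_uniq.
by move=> z; rewrite !mem_undup => /s12.
Qed.

Lemma range_size_cat y p q :
  (range_size (y :: p ++ q) <= range_size (y :: p) + range_size (last y p :: q))%N.
Proof.
rewrite -!size_undup_range -size_cat; apply: uniq_leq_size.
  exact: undup_uniq.
move=> z; rewrite mem_cat !mem_undup -cat_cons mem_cat => /orP[->//|zq].
by rewrite [in X in _ || X]inE zq !orbT.
Qed.

Lemma tally_le phi s : (tally phi s <= size s)%N.
Proof. by elim: s => //= z s IH; case: (phi z s) => /=; lia. Qed.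

(** A point last seen in the block [y :: p], early enough, is either last seen
    there in the whole path or makes a late return. *)
Lemma early_last_cat g y p q : (0 < g)%N ->
  (early_last g (y :: p) + (range_size (last y p :: q) + late_returns g (last y p :: q))
   <= range_size (y :: p ++ q) + late_returns g (y :: p ++ q))%N.
Proof.
move=> g0; elim: p y => [|z p IH] y /=.
  by rewrite /early_last /= leqn0 eqn0Ngt g0.
have := IH z.
rewrite /early_last /range_size /late_returns /=.
set a := (X in (X <= _)%N -> _); set b := (X in (_ <= X)%N -> _).
have aux s : (((g <= size s)%N && (y \notin s)) <=
  (y \notin s ++ q) + ((y \notin take g (s ++ q)) && (y \in s ++ q)))%N.
  case: (leqP g (size s)) => //= gs.
  rewrite takel_cat//; case: (boolP (y \in s)) => //= ys.
  have -> : y \notin take g s by apply: contra ys; exact: mem_take.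
  by case: (y \in s ++ q).
have := aux (z :: p); rewrite /a /b /=; lia.
Qed.

(** The sum of [F] over the first [K] blocks of [m] steps of [y :: s]. *)
Fixpoint blocks (F : seq V -> nat) m K y s : nat :=
  if K is K'.+1 then
    (F (y :: take m s) + blocks F m K' (last y (take m s)) (drop m s))%N
  else 0%N.

Lemma range_size_blocks m K y s : (size s <= K * m)%N -> (0 < K)%N ->
  (range_size (y :: s) <= blocks range_size m K y s)%N.
Proof.
elim: K y s => [//|[|K] IH] y s sK _.
  by rewrite /= take_oversize ?addn0//; lia.
rewrite -{1}(cat_take_drop m s).
apply: leq_trans (range_size_cat _ _ _) _.
rewrite [leqRHS]/= -/(blocks _ _ K.+1 _ _) leq_add2l IH//.
by rewrite size_drop; lia.
Qed.

Lemma early_last_blocks g m K y s : (0 < g)%N -> (K * m <= size s)%N ->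
  (blocks (early_last g) m K y s
   <= range_size (y :: s) + late_returns g (y :: s))%N.
Proof.
move=> g0; elim: K y s => [//|K IH] y s sK /=.
rewrite -{4 5}(cat_take_drop m s).
apply: leq_trans (early_last_cat _ _ _ g0); rewrite leq_add2l IH//.
by rewrite size_drop; lia.
Qed.

Lemma blocks_take F m K y s n : (K * m <= n)%N ->
  blocks F m K y (take n s) = blocks F m K y s.
Proof.
elim: K y s n => [//|K IH] y s n Kn /=.
have mn : (m <= n)%N by lia.
rewrite take_takel//; congr (_ + _)%N.
have -> : drop m (take n s) = take (n - m) (drop m s).
  by rewrite take_drop subnK.
by apply: IH; lia.
Qed.

End PathCounts.

(** * Means and exponential moments of the counting functionals *)

Section CountMeans.
Context (R : realType) (V : choiceType) (N : V -> seq V).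
Context (N_gt0 : forall x, (0 < size (N x))%N).
Implicit Types (x y z : V) (p q s : seq V).
Local Notation E := (@path_mean R V N).

Lemma mean_tallyS (phi : V -> seq V -> bool) n y :
  E n.+1 y (fun p => (tally phi (y :: p))%:R)
  = E n.+1 y (fun p => (phi y p)%:R)
    + nbr_mean N (fun z => E n z (fun p => (tally phi (z :: p))%:R)) y.
Proof.
rewrite -[X in _ + X]/(E n.+1 y (fun p => (tally phi p)%:R)) -path_meanD.
by apply: path_mean_eq => p _ _ /=; rewrite natrD.
Qed.

Lemma mean_tally_le (phi : V -> seq V -> bool) n y (b : nat -> R) :
  (forall m z, (m <= n)%N -> E m z (fun p => (phi z p)%:R) <= b m) ->
  E n y (fun p => (tally phi (y :: p))%:R) <= \sum_(m < n.+1) b m.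
Proof.
elim: n y => [|n IH] y hb.
  by rewrite big_ord1 /= addn0; exact: (hb 0%N y).
rewrite mean_tallyS big_ord_recr [leLHS]addrC; apply: lerD; last exact: (hb n.+1 y).
rewrite -[leRHS](nbr_mean_cst N_gt0 _ y); apply: nbr_mean_le => z _.
by apply: IH => m w mn; apply: hb; rewrite leqW.
Qed.

Lemma mean_tally_ge (phi : V -> seq V -> bool) n y (b : nat -> R) :
  (forall m z, (m <= n)%N -> b m <= E m z (fun p => (phi z p)%:R)) ->
  \sum_(m < n.+1) b m <= E n y (fun p => (tally phi (y :: p))%:R).
Proof.
elim: n y => [|n IH] y hb.
  by rewrite big_ord1 /= addn0; exact: (hb 0%N y).
rewrite mean_tallyS big_ord_recr [leRHS]addrC; apply: lerD; last exact: (hb n.+1 y).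
rewrite -[leLHS](nbr_mean_cst N_gt0 _ y); apply: nbr_mean_le => z _.
by apply: IH => m w mn; apply: hb; rewrite leqW.
Qed.

Lemma mean_range_ge n y (i : R) : (forall z, i <= escape R N n z) ->
  n.+1%:R * i <= E n y (fun p => (range_size (y :: p))%:R).
Proof.
move=> hi; have -> : n.+1%:R * i = \sum_(m < n.+1) i.
  by rewrite sumr_const card_ord mulr_natl.
apply: (@mean_tally_ge _ n y (fun=> i)) => m z mn.
by apply: le_trans (hi z) _; exact: escape_le.
Qed.

(** The first [a] terms are at most [1], the others at most [i]. *)
Lemma mean_range_le n a y (i : R) : (forall z, escape R N a z <= i) ->
  E n y (fun p => (range_size (y :: p))%:R) <= a%:R + n.+1%:R * i.
Proof.
move=> hi; have i0 : 0 <= i by apply: le_trans (hi y); exact: escape_ge0.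
pose b m : R := if (m < a)%N then 1 + i else i.
apply: (@le_trans _ _ (\sum_(m < n.+1) b m)).
  apply: mean_tally_le => m z mn; rewrite -/(escape R N m z) /b.
  case: ltnP => ma; first by rewrite ler_wpDr// escape_le1.
  by apply: le_trans (hi z); exact: escape_le.
have -> : \sum_(m < n.+1) b m = \sum_(m < n.+1) (m < a)%:R + n.+1%:R * i.
  rewrite mulr_natl -[X in i *+ X]card_ord -sumr_const -big_split /=.
  by apply: eq_bigr => m _; rewrite /b; case: ifP => _; rewrite ?add0r.
rewrite lerD2r -natr_sum ler_nat.
elim: (n.+1) => [|k IH]; first by rewrite big_ord0.
rewrite big_ord_recr /=; case: (ltnP k a) => ka; last by rewrite addn0.
rewrite addn1; apply: leq_trans ka; rewrite ltnS.
apply: leq_trans (_ : \sum_(m < k) 1 <= k)%N.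
  by apply: leq_sum => m _; exact: leq_b1.
by rewrite sum1_card card_ord.
Qed.

Lemma mean_early_last_ge g n y (i : R) : 0 <= i ->
  (forall z, i <= escape R N n z) ->
  (n.+1%:R - g%:R) * i <= E n y (fun p => (early_last g (y :: p))%:R).
Proof.
move=> i0 hi; pose b m : R := (g <= m)%:R * i.
apply: (@le_trans _ _ (\sum_(m < n.+1) b m)); last first.
  apply: mean_tally_ge => m z mn; rewrite /b.
  rewrite (_ : E _ _ _ = (g <= m)%:R * escape R N m z).
    rewrite ler_wpM2l//; apply: le_trans (hi z) _; exact: escape_le.
  rewrite /escape -path_meanZ; apply: path_mean_eq => p sp _.
  by rewrite sp; case: (g <= m)%N; rewrite ?mul1r ?mul0r.
rewrite /b -mulr_suml ler_wpM2r// lerBlDr -natr_sum -natrD ler_nat.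
elim: (n.+1) => [//|k IH]; rewrite big_ord_recr /=.
case: (leqP g k) => gk /=; first by rewrite addn1 addSn ltnS.
by rewrite addn0 (leq_trans gk)// leq_addl.
Qed.

Lemma mean_late_returns_le g n y (om : R) :
  (forall m z, (m <= n)%N ->
     E m z (fun p => ((z \notin take g p) && (z \in p))%:R) <= om) ->
  E n y (fun p => (late_returns g (y :: p))%:R) <= n.+1%:R * om.
Proof.
move=> hom; have -> : n.+1%:R * om = \sum_(m < n.+1) om.
  by rewrite sumr_const card_ord mulr_natl.
by apply: (@mean_tally_le _ n y (fun=> om)).
Qed.

(** The exponential moments multiply, by the Markov property at the end of each
    block. *)
Lemma mean_exp_blocks (F : seq V -> nat) m K y (th rho : R) : 0 <= rho ->
  (forall z, E m z (fun p => expR (th * (F (z :: p))%:R)) <= rho) ->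
  E (K * m) y (fun p => expR (th * (blocks F m K y p)%:R)) <= rho ^+ K.
Proof.
move=> rho0 hrho; elim: K y => [|K IH] y; first by rewrite /= mulr0 expR0.
rewrite mulSn path_mean_cat exprS.
apply: (@le_trans _ _ (E m y (fun p => rho ^+ K * expR (th * (F (y :: p))%:R)))).
  apply: path_mean_le => p sp _; rewrite mulrC.
  apply: le_trans (ler_wpM2l (expR_ge0 _) (IH (last y p))).
  rewrite -path_meanZ; apply: path_mean_le => q _ _ /=.
  by rewrite take_size_cat// drop_size_cat// natrD mulrDr expRD.
by rewrite path_meanZ mulrC ler_wpM2r ?exprn_ge0.
Qed.

(** From [exp (- v) >= 1 - v], so [exp v <= 1 + v / (1 - v)]. *)
Lemma expR_le_linear (eta v : R) : 0 <= v <= eta -> eta <= 2^-1 ->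
  expR v <= 1 + (1 + 2 * eta) * v.
Proof.
move=> /andP[v0 ve] e2; have := expR_ge1Dx (- v).
rewrite expRN => h; have e0 := expR_gt0 v.
have : (1 - v) * expR v <= 1 by rewrite -ler_pdivlMr// mul1r.
move: (expR v) e0 => w w0 hw.
have : w * (1 - v) <= (1 + (1 + 2 * eta) * v) * (1 - v) by nra.
rewrite ler_pM2r//; lra.
Qed.

Lemma expRN_le_linear (eta v : R) : 0 <= v <= eta -> eta <= 1 ->
  expR (- v) <= 1 - (1 - eta) * v.
Proof.
move=> /andP[v0 ve] e2; have := expR_ge1Dx v.
rewrite expRN => h; have e0 := expR_gt0 v.
rewrite -[_^-1]mul1r ler_pdivrMr//.
apply: (@le_trans _ _ ((1 - (1 - eta) * v) * (1 + v))); first by nra.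
by rewrite ler_wpM2l//; nra.
Qed.

(** Upper tail of the range: cut the path into [K] blocks of [m] steps. *)
Lemma range_upper_tail n m K y (u eta : R) : (n <= K * m)%N -> (0 < K)%N ->
  0 < eta <= 2^-1 -> 0 <= u ->
  (forall z, E m z (fun p => (range_size (z :: p))%:R) <= u) ->
  E n y (fun p => ((1 + 3 * eta) * (K%:R * u) <= (range_size (y :: p))%:R)%R%:R)
  <= expR (- (eta ^+ 2 * (K%:R * u) / m.+1%:R)).
Proof.
move=> nKm K0 /andP[eta0 eta2] u0 hu.
(* The range of a block is at most [m + 1], so [th] times it is at most [eta]. *)
pose th := eta / m.+1%:R.
have th0 : 0 < th by rewrite divr_gt0// ltr0n.
pose rho := 1 + (1 + 2 * eta) * th * u.
have hrho z : E m z (fun p => expR (th * (range_size (z :: p))%:R)) <= rho.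
  apply: (@le_trans _ _ (E m z (fun p =>
      1 + (1 + 2 * eta) * th * (range_size (z :: p))%:R))).
    apply: path_mean_le => p sp _; rewrite -mulrA; apply: expR_le_linear => //.
    rewrite mulr_ge0 ?(ltW th0)//= /th mulrAC ler_pdivrMr ?ltr0n// ler_pM2l// ler_nat.
    by apply: leq_trans (tally_le _ _) _; rewrite /= sp.
  rewrite path_meanD path_mean_cst// path_meanZ lerD2l ler_wpM2l//.
  by apply: mulr_ge0; [lra|exact: ltW].
have rho_ge1 : 1 <= rho.
  by rewrite lerDl mulr_ge0// mulr_ge0//; [lra|exact: ltW].
set b := (1 + 3 * eta) * (K%:R * u).
apply: (@le_trans _ _ (E (K * m) y (fun p =>
    expR (- (th * b)) * expR (th * (blocks (@range_size V) m K y p)%:R)))).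
  rewrite -{1}(subnKC nKm) -(path_mean_take N_gt0 n (K * m - n)).
  apply: path_mean_le => p sp _; rewrite -expRD.
  case: (leP b) => hb; last exact: expR_ge0.
  rewrite (le_trans _ (expR_ge1Dx _))// lerDl addrC -mulrBr mulr_ge0 ?(ltW th0)//.
  rewrite subr_ge0; apply: le_trans hb _; rewrite ler_nat.
  apply: leq_trans (range_size_blocks (m := m) y _ K0); last by rewrite sp subnKC.
  by apply: range_size_le => z; rewrite !inE => /orP[->//|/mem_take ->]; rewrite orbT.
rewrite path_meanZ.
have := mean_exp_blocks K y (le_trans ler01 rho_ge1) hrho.
move=> /(ler_wpM2l (expR_ge0 (- (th * b)))) /le_trans; apply.
have hr : rho <= expR ((1 + 2 * eta) * th * u) by exact: expR_ge1Dx.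
apply: (@le_trans _ _ (expR (- (th * b)) * expR ((1 + 2 * eta) * th * u) ^+ K)).
  by rewrite ler_wpM2l ?expR_ge0// lerXn2r// nnegrE ?expR_ge0// (le_trans ler01).
rewrite -expRM_natl -expRD ler_expR /b /th le_eqVlt; apply/orP; left; apply/eqP.
by field; rewrite addrC natr1 pnatr_eq0.
Qed.

(** Lower tail of the range: the range is at least the number of points seen
    early enough in their block for the last time in the block, but for those
    which make a late return. *)
Lemma range_lower_tail n m K g y (i om eta b1 b2 : R) :
  (K * m <= n)%N -> (0 < g)%N -> 0 < eta <= 1 -> 0 <= i -> 0 < b2 ->
  (forall z, i <= escape R N m z) ->
  (forall k z, (k <= n)%N ->
     E k z (fun p => ((z \notin take g p) && (z \in p))%:R) <= om) ->
  E n y (fun p => ((range_size (y :: p))%:R <= b1)%R%:R)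
  <= expR (eta / m.+1%:R
        * (b1 + b2 - (1 - eta) * (K%:R * ((m.+1%:R - g%:R) * i))))
     + n.+1%:R * om / b2.
Proof.
move=> Kmn g0 /andP[eta0 eta1] i0 b20 hi hom.
pose th := eta / m.+1%:R; rewrite -/th.
have th0 : 0 < th by rewrite divr_gt0// ltr0n.
pose be := (m.+1%:R - g%:R) * i; rewrite -/be.
pose rho := expR (- ((1 - eta) * th * be)).
have hrho z : E m z (fun p => expR (- th * (early_last g (z :: p))%:R)) <= rho.
  apply: (@le_trans _ _ (E m z (fun p =>
      1 + - ((1 - eta) * th) * (early_last g (z :: p))%:R))).
    apply: path_mean_le => p sp _; rewrite !mulNr -[_ * th * _]mulrA.
    apply: expRN_le_linear => //.
    rewrite mulr_ge0 ?(ltW th0)//= /th mulrAC ler_pdivrMr ?ltr0n// ler_pM2l// ler_nat.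
    by apply: leq_trans (tally_le _ _) _; rewrite /= sp.
  rewrite path_meanD path_mean_cst// path_meanZ.
  apply: le_trans (expR_ge1Dx _).
  rewrite lerD2l mulNr lerN2 ler_wpM2l//.
    by rewrite mulr_ge0 ?subr_ge0// ltW.
  exact: mean_early_last_ge.
apply: (@le_trans _ _ (E n y (fun p =>
   expR (th * (b1 + b2)) * expR (- th * (blocks (early_last g) m K y (take (K * m) p))%:R)
   + b2^-1 * (late_returns g (y :: p))%:R))).
  apply: path_mean_le => p sp _.
  rewrite blocks_take// -expRD mulNr -mulrBr.
  case: (leP _ b1) => hb; last first.
    by rewrite addr_ge0 ?expR_ge0// mulr_ge0// invr_ge0 ltW.
  have [lb2|lb2] := leP b2 (late_returns g (y :: p))%:R.
    rewrite ler_wpDl ?expR_ge0//.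
    by rewrite mulrC ler_pdivlMr// mul1r.
  rewrite ler_wpDr//; first by rewrite mulr_ge0// invr_ge0 ltW.
  rewrite (le_trans _ (expR_ge1Dx _))// lerDl mulr_ge0 ?(ltW th0)//.
  rewrite subr_ge0; apply: le_trans (lerD hb (ltW lb2)).
  by rewrite -natrD ler_nat early_last_blocks// sp.
rewrite path_meanD !path_meanZ; apply: lerD; last first.
  rewrite mulrC ler_wpM2r ?invr_ge0 ?(ltW b20)//.
  exact: mean_late_returns_le.
have -> : n = (K * m + (n - K * m))%N by rewrite subnKC.
rewrite (path_mean_take N_gt0 _ _ _ (fun p =>
  expR (- th * (blocks (early_last g) m K y p)%:R))).
have := mean_exp_blocks K y (expR_ge0 _) hrho.
move=> /(ler_wpM2l (expR_ge0 (th * (b1 + b2)))) /le_trans; apply.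
rewrite -expRM_natl -expRD ler_expR.
rewrite le_eqVlt; apply/orP; left; apply/eqP; ring.
Qed.

End CountMeans.

(** * Asymptotic parameters *)

Section Scales.
Context (R : realType).
Implicit Types (l s L : R) (n : nat).

(** The number of blocks into which a path of [n] steps is cut: the integer part
    of [(ln n)^4], plus one. *)
Definition nblocks n : nat := (Num.truncn (ln n%:R ^+ 4 : R)).+1.

(** The fourth root. *)
Definition root4 l : R := Num.sqrt (Num.sqrt l).

Lemma root4X l : 0 <= l -> root4 l ^+ 4 = l.
Proof. by move=> l0; rewrite (exprM _ 2 2) !sqr_sqrtr// sqrtr_ge0. Qed.

Lemma ln_ge_near L : exists n0, forall n, (n0 <= n)%N -> L <= ln n%:R.
Proof.
exists (Num.truncn (expR L)).+1 => n n0.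
have : expR L < n%:R.
  by apply: lt_le_trans (truncnS_gt _) _; rewrite ler_nat.
move=> h; rewrite -[L]expRK ler_ln ?posrE ?expR_gt0// ?ltW//.
exact: lt_trans (expR_gt0 L) h.
Qed.

Lemma nblocks_bounds n : 1 <= ln n%:R :> R ->
  ln n%:R ^+ 4 <= (nblocks n)%:R :> R /\ (nblocks n)%:R <= 2 * ln n%:R ^+ 4 :> R.
Proof.
move=> l1; have l40 : 0 <= ln n%:R ^+ 4 :> R.
  by rewrite exprn_ge0// (le_trans _ l1).
split; first exact/ltW/truncnS_gt.
rewrite /nblocks -natr1 mulrDl mul1r; apply: lerD; first by rewrite truncn_le.
by rewrite exprn_ege1.
Qed.

(** Since [l ^ 9 / 9! <= exp l] with [l = ln n]. *)
Lemma sqr_nblocks_le n : 9`!%:R * 4 <= ln n%:R :> R -> (nblocks n ^ 2 <= n)%N.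
Proof.
move=> hl; have f1 : 1 <= 9`!%:R :> R by rewrite ler1n fact_gt0.
have l1 : 1 <= ln n%:R :> R by apply: le_trans hl; lra.
have [_ Kl] := nblocks_bounds l1.
have n0 : 0 < n%:R :> R.
  rewrite ltr0n lt0n; apply/eqP => n0; move: l1; rewrite n0 ln0//.
  by rewrite leNgt ltr01.
rewrite -(ler_nat R) natrX -[leRHS](lnK n0).
move: (ln n%:R) hl l1 Kl => l hl l1 Kl.
have l0 : 0 <= l by exact: le_trans l1.
apply: (@le_trans _ _ ((2 * l ^+ 4) ^+ 2)).
  by rewrite lerXn2r// nnegrE ?mulr_ge0// exprn_ge0.
apply: le_trans (_ : l ^+ 9 / 9`!%:R <= _); last first.
  by apply: le_trans (expR_ge1Dxn 8 l0); rewrite lerDr.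
rewrite ler_pdivlMr ?ltr0n ?fact_gt0// exprMn -exprM [l ^+ 9]exprS.
have -> : 2 ^+ 2 = 4 :> R by rewrite expr2; lra.
by rewrite mulrAC ler_wpM2r ?exprn_ge0// mulrC.
Qed.

(** With [l = ln n], [s] the fourth root of [l] and [K] the number of blocks,
    [ln K] is at most [17 s], hence negligible with respect to [l = s ^ 4]. *)
Lemma scales_near L : exists n0, forall n, (n0 <= n)%N ->
  [/\ (1 <= n)%N, L <= ln n%:R, L <= root4 (ln n%:R), 1 <= root4 (ln n%:R) &
   [/\ L <= (nblocks n)%:R, (nblocks n ^ 2 <= n)%N,
     ln n%:R ^+ 4 <= (nblocks n)%:R :> R &
     ln (nblocks n)%:R <= 17 * root4 (ln n%:R)]].
Proof.
pose L1 : R := Num.max 1 L.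
have [n0 hn0] := ln_ge_near (Num.max (L1 ^+ 4) (9`!%:R * 4)).
exists n0 => n /hn0; rewrite ge_max => /andP[hl hK].
have L11 : 1 <= L1 by rewrite le_max lexx.
have LL1 : L <= L1 by rewrite le_max lexx orbT.
have l1 : 1 <= ln n%:R :> R by apply: le_trans hl; rewrite exprn_ege1.
have l0 : 0 <= ln n%:R :> R by exact: le_trans l1.
have [Kg Kl] := nblocks_bounds l1.
have n1 : (1 <= n)%N.
  rewrite lt0n; apply/eqP => n0E; move: l1; rewrite n0E ln0//.
  by rewrite leNgt ltr01.
have hs : L1 <= root4 (ln n%:R).
  by rewrite -(@ler_pXn2r _ 4)// ?root4X// nnegrE ?sqrtr_ge0// (le_trans _ L11).
have s1 : 1 <= root4 (ln n%:R) by exact: le_trans hs.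
have L4 : L1 <= L1 ^+ 4 by rewrite ler_eXnr.
split => //.
- by apply: le_trans hl; exact: le_trans LL1 _.
- exact: le_trans hs.
split => //; last 1 first.
- have K0 : 0 < (nblocks n)%:R :> R by rewrite ltr0n.
  have s0 : 0 < root4 (ln n%:R) by exact: lt_le_trans s1.
  apply: (@le_trans _ _ (ln (2 * ln n%:R ^+ 4))).
    by rewrite ler_ln// posrE mulr_gt0// exprn_gt0// (lt_le_trans _ l1).
  rewrite -{1}(root4X l0) -exprM lnM ?posrE ?exprn_gt0//.
  rewrite lnXn//; have := ln_sublinear s0.
  have : ln 2 <= 1 :> R by have := @le_ln1Dx R 1; rewrite (_ : 1 + 1 = 2)//; apply; lra.
  by rewrite -mulr_natl; lra.
- apply: le_trans Kg; apply: (le_trans LL1); apply: (le_trans L4).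
  by apply: (le_trans hl); rewrite ler_eXnr.
- exact: sqr_nblocks_le.
Qed.

(** [a = n / K^2 + 1] is at most [2n / K^2], and its logarithm is close to
    [ln n]. *)
Lemma cutoff_bounds n K : (0 < K)%N -> (K ^ 2 <= n)%N ->
  let a := (n %/ K ^ 2).+1 in
  [/\ a%:R * K%:R ^+ 2 <= 2 * n%:R :> R,
      ln n%:R - 2 * ln K%:R <= ln a%:R :> R & (a <= n.+1)%N].
Proof.
move=> K0 Kn a.
have K20 : (0 < K ^ 2)%N by rewrite expn_gt0 K0.
have n0 : (0 < n)%N by exact: leq_trans Kn.
have := divn_eq n (K ^ 2); have := ltn_pmod n K20.
rewrite /a; set q := (n %/ _)%N; set r := (n %% _)%N => rK nE.
split; last by rewrite ltnS leq_div.
- rewrite -natrX -!natrM ler_nat mulSn [leqRHS]mul2n -addnn.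
  by apply: leq_add => //; rewrite [leqRHS]nE leq_addr.
- have KR : 0 < K%:R :> R by rewrite ltr0n.
  rewrite lerBlDl -[2 * _]/(2%:R * _) mulr_natl -lnXn// -lnM ?posrE ?exprn_gt0//.
  rewrite ler_ln ?posrE ?ltr0n// ?mulr_gt0 ?exprn_gt0// -natrX -natrM ler_nat.
  by rewrite mulnS [leqLHS]nE mulnC addnC leq_add2r ltnW.
Qed.

End Scales.

Section HarmonicSums.
Context (R : realType).

Lemma ln_succ_le (x : R) : 0 < x -> ln (x + 1) - ln x <= x^-1.
Proof.
move=> x0; rewrite -ln_div ?posrE ?addr_gt0//.
by rewrite mulrDl mul1r divff ?gt_eqF// le_ln1Dx// (lt_trans (ltrN10 _))// invr_gt0.
Qed.

Lemma ln_succ_ge (x : R) : 0 < x -> (x + 1)^-1 <= ln (x + 1) - ln x.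
Proof.
move=> x0; have x10 : 0 < x + 1 by rewrite addr_gt0.
rewrite -lerN2 opprB -ln_div ?posrE//.
have -> : x / (x + 1) = 1 + - (x + 1)^-1.
  by field; rewrite lt0r_neq0.
by rewrite le_ln1Dx// ltrN2 invf_lt1// ltrDr.
Qed.

Lemma ln_le_sum_inv n : ln n.+1%:R <= \sum_(k < n) k.+1%:R^-1 :> R.
Proof.
elim: n => [|n IH]; first by rewrite big_ord0 ln1.
rewrite big_ord_recr /= -lerBlDl; apply: le_trans (lerB (lexx _) IH) _.
by rewrite -natr1 ln_succ_le.
Qed.

Lemma sum_inv_le_ln a n : (0 < a)%N ->
  \sum_(k < n.+1) (a + k)%:R^-1 <= 1 + (ln (a + n)%:R - ln a%:R) :> R.
Proof.
move=> a0; elim: n => [|n IH].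
  by rewrite big_ord1 addn0 subrr addr0 invf_le1 ?ler1n ?ltr0n.
rewrite big_ord_recr /=; apply: le_trans (lerD IH (lexx _)) _.
have an0 : 0 < (a + n)%:R :> R by rewrite ltr0n addn_gt0 a0.
by have := ln_succ_ge an0; rewrite natr1 -addnS; lra.
Qed.

End HarmonicSums.

(** * Tail estimates for the range *)

Section RangeTails.
Context (R : realType) (V : choiceType) (N : V -> seq V).
Context (N_gt0 : forall x, (0 < size (N x))%N).
Implicit Types (x y z : V).
Local Notation E := (@path_mean R V N).
Local Notation escape := (@escape R V N).

Section Upper.
Context (r0 r1 : R) (r01 : r0 < r1) (r00 : 0 <= r0).
Context (escape_up : exists n0, forall n y, (n0 <= n)%N ->
  ln n%:R * escape n y <= r0).

(** All paths of at least [n / K] steps satisfy the bound with [ln n] instead of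
    the logarithm of their own length. *)
Lemma mean_range_upper : exists n0, forall n m y, (n0 <= n)%N ->
  (n %/ nblocks R n <= m)%N ->
  E m y (fun p => (range_size (y :: p))%:R) <= r1 * m.+1%:R / ln n%:R.
Proof.
have [e0 he] := escape_up.
have [d d0 ->] : exists2 d : R, 0 < d & r1 = r0 + d + d.
  by exists ((r1 - r0) / 2); [rewrite divr_gt0// subr_gt0|field].
(* [L] is a lower bound for [l] and [s]: from [68 <= s] follows
   [l / 2 <= l - 34 s <= ln a], where [34 s] bounds [2 ln K]; the other terms
   make [34 s] and [a l] negligible, and [a] larger than [e0]. *)
pose L := 68 + 34 * (r0 + d) / d + 2 / d + 2 * e0%:R.
have [L1 L2 L3 L4] : [/\ 68 <= L, 34 * (r0 + d) / d <= L, 2 / d <= L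
    & 2 * e0%:R <= L].
  have h1 : 0 <= 34 * (r0 + d) / d by rewrite divr_ge0 ?(ltW d0)// mulr_ge0// addr_ge0// ltW.
  have h2 : 0 <= 2 / d by rewrite divr_ge0// ltW.
  have h3 := ler0n R e0.
  by rewrite /L; split; lra.
have [n0 hn0] := scales_near L.
exists n0 => n m y /hn0[n1 Ll Ls s1 [_ Kn lK lnKs]] nKm.
have l0 : 0 <= ln n%:R :> R by apply: le_trans Ll; lra.
have [aK lna an] := cutoff_bounds R (isT : 0 < nblocks R n)%N Kn.
have := root4X l0.
set l := ln n%:R in Ll Ls s1 lK lnKs l0 aK lna an *.
set s := root4 l in Ls s1 lnKs *.
set a := (n %/ _).+1 in aK lna an *; set K := nblocks R n in nKm aK lna Kn lK lnKs *.
move=> sl.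
have ls : L * s <= l.
  rewrite -sl [s ^+ 4]exprS mulrC ler_wpM2l ?(le_trans ler01)//.
  by apply: (le_trans Ls); rewrite ler_eXnr.
have lnal : l - 34 * s <= ln a%:R by apply: le_trans lna; lra.
have l1 : 0 < l by lra.
have lna0 : 0 < ln a%:R :> R by apply: lt_le_trans lnal; nra.
have e0a : (e0 <= a)%N.
  rewrite -(ler_nat R); apply: (@le_trans _ _ (expR (ln a%:R))); last first.
    by rewrite lnK ?posrE ?ltr0n.
  by apply: le_trans (expR_ge1Dx _); nra.
have esc z : escape a z <= (r0 + d) / l.
  have := he a z e0a; rewrite mulrC -ler_pdivlMr// => /le_trans; apply.
  rewrite ler_pdivrMr// mulrAC ler_pdivlMr//.
  have : (r0 + d) * (l - 34 * s) <= (r0 + d) * ln a%:R by apply: ler_wpM2l => //; rewrite addr_ge0 // ltW.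
  have : 34 * (r0 + d) <= L * d by rewrite -ler_pdivrMr.
  by nra.
apply: le_trans (mean_range_le N_gt0 m y esc) _.
have Km : n%:R <= m.+1%:R * K%:R :> R.
  by rewrite -natrM ler_nat ltnW// -ltn_divLR// ltnS.
have K0 : 0 < K%:R :> R by rewrite ltr0n.
have aK1 : a%:R * K%:R <= 2 * m.+1%:R :> R.
  by rewrite -(ler_pM2r K0); move: aK; rewrite expr2; lra.
have lK2 : 2 * l <= d * K%:R.
  have : 2 <= L * d by rewrite -ler_pdivrMr.
  have : l * l <= K%:R.
    apply: le_trans lK; rewrite -expr2 ler_weXn2l//; lra.
  nra.
have : a%:R <= d * m.+1%:R / l.
  rewrite ler_pdivlMr// -(ler_pM2r K0).
  have : a%:R * K%:R * l <= 2 * m.+1%:R * l by rewrite ler_wpM2r.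
  have : m.+1%:R * (2 * l) <= m.+1%:R * (d * K%:R) by rewrite ler_wpM2l.
  nra.
move=> h; apply: le_trans (lerD h (lexx _)) _.
by rewrite le_eqVlt; apply/orP; left; apply/eqP; field; rewrite gt_eqF.
Qed.

End Upper.

Lemma mul_divn_succ_le n k : (k * (n %/ k).+2 <= n + 2 * k)%N.
Proof. by rewrite !mulnS addnA addnn -mul2n addnC leq_add2r mulnC leq_divM. Qed.

(** The upper tail of the range is summable. *)
Lemma range_upper_le (r0 r2 : R) : 0 <= r0 < r2 ->
  (exists n0, forall n y, (n0 <= n)%N -> ln n%:R * escape n y <= r0) ->
  exists n0, forall n y, (n0 <= n)%N ->
  E n y (fun p => (r2 * (n%:R / ln n%:R) <= (range_size (y :: p))%:R)%R%:R)
    <= (n%:R ^+ 2)^-1.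
Proof.
move=> /andP[r00 r02] hesc.
have [r1 r01 r12] : exists2 r1 : R, r0 < r1 & r1 < r2.
  by exists ((r0 + r2) / 2); lra.
have r10 : 0 < r1 by exact: le_lt_trans r01.
have [n1 hmean] := mean_range_upper r01 r00 hesc.
(* Chosen such that [(1 + 3 eta) (1 + eta) r1 <= r2], as [eta <= 1]. *)
pose eta := (r2 - r1) / (2 * (7 * r1 + r2)).
have den0 : 0 < 2 * (7 * r1 + r2) by lra.
have eta0 : 0 < eta by rewrite divr_gt0// subr_gt0.
have eta2 : eta <= 2^-1 by rewrite ler_pdivrMr//; lra.
have eta7 : 7 * eta * r1 <= r2 - r1.
  have : eta * (2 * (7 * r1 + r2)) = r2 - r1 by rewrite divfK// gt_eqF.
  have : 0 < eta * r1 by exact: mulr_gt0.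
  have : 0 < eta * r2 by apply: mulr_gt0 => //; exact: lt_trans r12.
  by lra.
clearbody eta.
pose L := 1 + 2 / eta + 2 / (eta ^+ 2 * r1).
have e2r0 : 0 < eta ^+ 2 * r1 by rewrite mulr_gt0// exprn_gt0.
have [L1 L2 L3] : [/\ 1 <= L, 2 / eta <= L & 2 / (eta ^+ 2 * r1) <= L].
  have h1 : 0 <= 2 / eta by rewrite divr_ge0// ltW.
  have h2 : 0 <= 2 / (eta ^+ 2 * r1) by rewrite divr_ge0// ltW.
  by rewrite /L; split; lra.
have [n2 hn2] := scales_near L.
exists (maxn n1 n2) => n y; rewrite geq_max => /andP[nn1 /hn2].
move=> [n0 Ll _ _ [LK Kn lK _]].
pose m := (n %/ nblocks R n).+1.
have hm z := @hmean n m z nn1 (leqnSn _).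
move: hm; rewrite -/m.
have nKm : (n <= nblocks R n * m)%N.
  by rewrite ltnW// mulnC -ltn_divLR.
have Kmn : (nblocks R n * m.+1 <= n + 2 * nblocks R n)%N.
  exact: mul_divn_succ_le.
set l := ln n%:R in Ll lK *; set K := nblocks R n in LK Kn lK nKm Kmn *.
move=> hm.
have l1 : 1 <= l by exact: le_trans Ll.
have l0 : 0 < l by exact: lt_le_trans l1.
have nR0 : 0 < n%:R :> R by rewrite ltr0n.
have KR0 : 0 < K%:R :> R by rewrite ltr0n.
have Kn2 : K%:R * K%:R <= n%:R :> R by rewrite -natrM ler_nat mulnn.
have Kmn2 : K%:R * m.+1%:R <= n%:R + 2 * K%:R :> R.
  by rewrite -!natrM -natrD ler_nat.
have Keta : 2 * K%:R <= eta * n%:R.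
  have : 2 <= eta * K%:R by rewrite mulrC -ler_pdivrMr// (le_trans L2).
  by nra.
pose u := r1 * m.+1%:R / l.
have u0 : 0 <= u by rewrite divr_ge0 ?(ltW l0)// mulr_ge0// ltW.
have hub : (1 + 3 * eta) * (K%:R * u) <= r2 * (n%:R / l).
  rewrite /u !mulrA ler_pM2r ?invr_gt0//.
  have : K%:R * m.+1%:R <= (1 + eta) * n%:R by lra.
  have h : (1 + 3 * eta) * (1 + eta) * r1 <= r2 by nra.
  move=> h'; rewrite (_ : _ * m.+1%:R
      = ((1 + 3 * eta) * r1) * (K%:R * m.+1%:R)); last by ring.
  apply: (@le_trans _ _ (((1 + 3 * eta) * r1) * ((1 + eta) * n%:R))).
    by apply: ler_wpM2l => //; rewrite mulr_ge0 ?(ltW r10)//; lra.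
  by rewrite mulrA ler_pM2r//; lra.
apply: (@le_trans _ _ (E n y (fun p =>
    ((1 + 3 * eta) * (K%:R * u) <= (range_size (y :: p))%:R)%R%:R))).
  apply: path_mean_le => p _ _; rewrite ler_nat; case: (leP (r2 * _)) => // h.
  by rewrite (le_trans hub h).
have := @range_upper_tail R V N N_gt0 n m K y u eta nKm isT.
rewrite eta0 eta2 => /(_ isT u0 hm) /le_trans; apply.
rewrite -[in leRHS](lnK (x := n%:R)) ?posrE// -expRM_natl -expRN ler_expR lerN2.
rewrite -/l /u.
have -> : eta ^+ 2 * (K%:R * (r1 * m.+1%:R / l)) / m.+1%:R
          = eta ^+ 2 * r1 * K%:R / l.
  by field; rewrite gt_eqF//= addrC natr1 pnatr_eq0.
rewrite ler_pdivlMr//.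
have h4 : 2 <= eta ^+ 2 * r1 * l by rewrite mulrC -ler_pdivrMr// (le_trans L3).
have h5 : l ^+ 3 <= K%:R.
  by apply: le_trans lK; rewrite ler_weXn2l.
have : l * l * 2 <= l * l * (eta ^+ 2 * r1 * l) by rewrite ler_wpM2l// mulr_ge0// ltW.
have : eta ^+ 2 * r1 * l ^+ 3 <= eta ^+ 2 * r1 * K%:R by rewrite ler_pM2l.
rewrite [l ^+ 3]exprS [l ^+ 2]expr2.
by lra.
Qed.

Lemma mean_range_upper_le (r0 r2 : R) : 0 <= r0 < r2 ->
  (exists n0, forall n y, (n0 <= n)%N -> ln n%:R * escape n y <= r0) ->
  exists n0, forall n y, (n0 <= n)%N ->
  E n y (fun p => (range_size (y :: p))%:R) <= r2 * (n%:R / ln n%:R).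
Proof.
move=> /andP[r00 r02] hesc.
have [r1 r01 r12] : exists2 r1 : R, r0 < r1 & r1 < r2.
  by exists ((r0 + r2) / 2); lra.
have r10 : 0 < r1 by exact: le_lt_trans r01.
have [n1 hmean] := mean_range_upper r01 r00 hesc.
have [n2 hn2] := ln_ge_near (Num.max 1 (r1 / (r2 - r1))).
exists (maxn n1 n2) => n y; rewrite geq_max => /andP[nn1 /hn2].
rewrite ge_max => /andP[l1 ln]; apply: le_trans (hmean n n y nn1 (leq_div _ _)) _.
have l0 : 0 < exp.ln n%:R :> R by exact: lt_le_trans l1.
have n0 : 0 < n%:R :> R.
  rewrite ltr0n lt0n; apply/eqP => n0; move: l1; rewrite n0 ln0//.
  by rewrite leNgt ltr01.
rewrite mulrA ler_pM2r ?invr_gt0// -natr1 mulrDr mulr1.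
have : r1 / (r2 - r1) <= n%:R by apply: le_trans ln _; exact/ltW/ln_sublinear.
by rewrite ler_pdivrMr ?subr_gt0//; lra.
Qed.

End RangeTails.

Section RangeLowerTail.
Context (R : realType) (V : choiceType) (N : V -> seq V).
Context (N_gt0 : forall x, (0 < size (N x))%N).
Implicit Types (x y z : V).
Local Notation E := (@path_mean R V N).
Local Notation escape := (@escape R V N).
Context (D : nat) (c C : R).
Context (N_uniq : forall x, uniq (N x)).
Context (N_sym : forall x y, (y \in N x) = (x \in N y)).
Context (N_le : forall x, (size (N x) <= D)%N).
Context (c0 : 0 < c).
Context (diag : forall n x, (1 <= n)%N ->
  c <= n%:R * (kernel R N n x x + kernel R N n.+1 x x) <= C).

Lemma green_ge n y : c * ln n%:R <= 2 * green R N n y.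
Proof.
case: n => [|n]; first by rewrite ln0// mulr0 mulr_ge0// green_ge0.
have shift j : (j <= 2)%N -> \sum_(k < n) kernel R N (j + k) y y <= green R N n.+1 y.
  move=> j2; have -> : green R N n.+1 y = \sum_(k < 2 - j + (j + n)) kernel R N k y y.
    by rewrite /green; have -> : (2 - j + (j + n) = n.+2)%N by lia.
  rewrite addnA addnC -(big_mkord xpredT (fun k => kernel R N k y y)).
  rewrite (@big_cat_nat _ _ _ (j + n) 0)//=; last by lia.
  rewrite ler_wpDr//; first by apply: sumr_ge0 => k _; exact: kernel_ge0.
  rewrite (@big_cat_nat _ _ _ j 0 (j + n))//=; last by lia.
  rewrite ler_wpDl//; first by apply: sumr_ge0 => k _; exact: kernel_ge0.
  rewrite -[X in \big[_/_]_(X <= _ < _ | _) _]add0n big_addn addKn big_mkord.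
  by apply: ler_sum => k _; rewrite addnC.
apply: le_trans (_ : \sum_(k < n) (kernel R N (1 + k) y y + kernel R N (2 + k) y y) <= _).
  apply: (le_trans (ler_wpM2l (ltW c0) (ln_le_sum_inv R n))).
  rewrite mulr_sumr; apply: ler_sum => k _.
  rewrite ler_pdivrMr ?ltr0n// mulrC.
  by case/andP: (@diag k.+1 y isT).
rewrite big_split mulrDl mul1r; apply: lerD; exact: shift.
Qed.

(** The sum over [k <= n] of [p_k(y, y)] is at least of order [ln n], whence the
    escape probability is at most of order [1 / ln n]. *)
Lemma escape_le_ln n y : (1 < n)%N -> escape n y <= 2 / (c * ln n%:R).
Proof.
move=> n1; have l0 : 0 < ln n%:R :> R by rewrite ln_gt0// ltr1n.
rewrite ler_pdivlMr ?mulr_gt0//.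
apply: (@le_trans _ _ (escape n y * (2 * green R N n y))).
  by rewrite ler_wpM2l ?escape_ge0// green_ge.
by have := escape_green R N_gt0 n y; lra.
Qed.

(** The constant of the off-diagonal bound. *)
Let C' : R := 2 * D%:R * C + 1.

Lemma C'_ge0 (z : V) : 0 <= C'.
Proof.
have C0 : 0 <= C.
  case/andP: (@diag 1%N z isT) => h1 h2; apply: le_trans h2.
  by apply: le_trans h1; exact: ltW.
by rewrite addr_ge0// !mulr_ge0.
Qed.

Lemma late_return_le n a k z : (1 < a)%N -> (a <= n.+1)%N -> (k <= n)%N ->
  E k z (fun p => ((z \notin take (a + a) p) && (z \in p))%:R)
  <= 4 * C' / (c ^+ 2 * ln a%:R * ln n%:R) * (4 + (ln n%:R - ln a%:R)).
Proof.
move=> a1 an kn; have [n0|n1] := leqP n 1.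
  rewrite (_ : E _ _ _ = 0).
    case: n an kn n0 => [|[|//]] an kn _; first by case: a a1 an => [|[|]].
    rewrite ln1 mulr0 invr0 mulr0 mul0r //.
  rewrite -(path_mean_cst N_gt0 k z 0); apply: path_mean_eq => p sp _.
  by rewrite take_oversize ?andNb// sp; lia.
have la0 : 0 < ln a%:R :> R by rewrite ln_gt0// ltr1n.
have ln0 : 0 < ln n%:R :> R by rewrite ln_gt0// ltr1n.
have C'0 := C'_ge0 z.
have hk j w : (0 < j)%N -> kernel R N j w z <= C' / j%:R.
  apply: (kernel_le N_gt0 N_uniq N_sym N_le) => i v i1.
  by case/andP: (@diag i v i1).
have := @late_return R V N N_gt0 k a n z C' hk (ltnW a1) C'0.
set X := E _ _ _ => hX.
have X0 : 0 <= X by apply: path_mean_ge0.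
have hS : \sum_(i < (k + n).+1) (a + i)%:R^-1 <= 4 + (ln n%:R - ln a%:R) :> R.
  apply: le_trans (sum_inv_le_ln R (k + n) (ltnW a1)) _.
  have : ln (a + (k + n))%:R <= ln (4 * n%:R) :> R.
    rewrite ler_ln ?posrE ?mulr_gt0 ?ltr0n//; try lia.
    by rewrite -natrM ler_nat; lia.
  rewrite lnM ?posrE ?ltr0n//; last by lia.
  have : ln 4 <= 3 :> R.
    by have := @le_ln1Dx R 3; rewrite (_ : 1 + 3 = 4); [apply|]; lra.
  by lra.
have hX2 : X * green R N n z <= 2 / (c * ln a%:R) * (C' * (4 + (ln n%:R - ln a%:R))).
  apply: le_trans hX _; apply: ler_pM.
  - exact: escape_ge0.
  - by rewrite mulr_ge0// sumr_ge0// => i _; rewrite invr_ge0.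
  - exact: escape_le_ln.
  - by rewrite ler_wpM2l.
have hX3 : X * (c * ln n%:R) <= 2 * (X * green R N n z).
  by rewrite [leRHS]mulrCA ler_wpM2l// green_ge.
rewrite -(@ler_pM2r _ (c * ln n%:R)) ?mulr_gt0//.
apply: (le_trans hX3).
apply: (@le_trans _ _ (2 * (2 / (c * ln a%:R) * (C' * (4 + (ln n%:R - ln a%:R)))))).
  by rewrite ler_pM2l.
rewrite le_eqVlt; apply/orP; left; apply/eqP; field.
by rewrite !gt_eqF.
Qed.

(** The lower tail is at most of order [(ln n)^(- 3 / 4)]; the paths of [n] steps
    are cut into [K] blocks of [m = n / K] steps, and a return is late after
    more than [g = 2 a] steps. *)
Lemma range_lower_le (r1 r2 : R) : 0 < r1 < r2 ->
  (exists n0, forall n y, (n0 <= n)%N -> r2 <= ln n%:R * escape n y) ->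
  exists B : R, exists n0, forall n y, (n0 <= n)%N ->
  E n y (fun p => ((range_size (y :: p))%:R <= r1 * (n%:R / ln n%:R))%R%:R)
    <= B / root4 (ln n%:R) ^+ 3.
Proof.
move=> /andP[r10 r12] [e0 he].
(* Then [r1 + eta - (1 - eta)^2 r2 <= - eta]: one [eta] is left for the late
   returns, and one for the exponent. *)
pose eta := (r2 - r1) / (2 + 2 * r2).
have r20 : 0 < r2 by exact: lt_trans r12.
have den0 : 0 < 2 + 2 * r2 by lra.
have eta0 : 0 < eta by rewrite divr_gt0// subr_gt0.
have eta1 : eta <= 1 by rewrite ler_pdivrMr//; lra.
have etaE : eta * (2 + 2 * r2) = r2 - r1 by rewrite divfK// gt_eqF.
clearbody eta.
pose L := 68 + 4 / eta + e0%:R.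
have [L1 L2 L3] : [/\ 68 <= L, 4 / eta <= L & e0%:R <= L].
  have h1 : 0 <= 4 / eta by rewrite divr_ge0// ltW.
  have h2 := ler0n R e0.
  by rewrite /L; split; lra.
have [n0 hn0] := scales_near L.
exists (2 / eta ^+ 2 + 608 * C' / (c ^+ 2 * eta)), n0.
move=> n y /hn0[n1 Ll Ls s1 [LK Kn lK lnKs]].
have l0 : 0 <= ln n%:R :> R by apply: le_trans Ll; lra.
have C'0 := C'_ge0 y.
have [aK lna an] := cutoff_bounds R (isT : 0 < nblocks R n)%N Kn.
have sl := root4X l0.
set l := ln n%:R in Ll Ls s1 lK lnKs l0 aK lna an sl *.
set s := root4 l in Ls s1 lnKs sl *.
set a := (n %/ _).+1 in aK lna an; set K := nblocks R n in LK aK lna Kn lK lnKs.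
have K0 : (0 < K)%N by [].
clearbody K.
have ls : 68 * s <= l.
  rewrite -sl [s ^+ 4]exprS mulrC ler_wpM2l ?(le_trans ler01)//.
  by apply: (le_trans L1); apply: (le_trans Ls); rewrite ler_eXnr.
have l1 : 0 < l by lra.
have lnal : l / 2 <= ln a%:R by apply: le_trans lna; lra.
have lna34 : l - 34 * s <= ln a%:R by apply: le_trans lna; lra.
have lna0 : 0 < ln a%:R :> R by lra.
have a1 : (1 < a)%N.
  rewrite ltnNge; apply/negP => a1; have : ln a%:R <= 0 :> R.
    by apply: ln_le0; rewrite lern1.
  by rewrite leNgt lna0.
have KR0 : 0 < K%:R :> R by rewrite ltr0n.
have nR0 : 0 < n%:R :> R by rewrite ltr0n.
pose m := (n %/ K)%N.
have Kmn : (K * m <= n)%N by rewrite mulnC leq_divM.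
have nKm : n%:R <= K%:R * m.+1%:R :> R.
  by rewrite -natrM ler_nat ltnW// mulnC -ltn_divLR.
have KK : K%:R * K%:R <= n%:R :> R by rewrite -natrM ler_nat mulnn.
have K1 : 1 <= K%:R :> R by rewrite ler1n.
have Km2 : K%:R * m.+1%:R <= 2 * n%:R :> R.
  have : K%:R * m%:R <= n%:R :> R by rewrite -natrM ler_nat.
  by rewrite -natr1 mulrDr mulr1; nra.
have e0m : (e0 <= m)%N.
  have h : K%:R <= m.+1%:R :> R.
    by rewrite -(ler_pM2l KR0); exact: le_trans nKm.
  have : e0%:R < m.+1%:R :> R.
    apply: lt_le_trans (_ : e0%:R + 1 <= _); first by lra.
    apply: (le_trans _ h); apply: le_trans lK.
    apply: (@le_trans _ _ (l ^+ 2)); last by rewrite ler_weXn2l//; lra.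
    by rewrite expr2; nra.
  by rewrite ltr_nat ltnS.
have mn : (m <= n)%N by exact: leq_div.
have hi z : r2 / l <= escape m z.
  rewrite ler_pdivrMr// mulrC; apply: le_trans (he m z e0m) _.
  rewrite ler_wpM2r ?escape_ge0//.
  have [->|m0] := posnP m; first by rewrite ln0.
  by rewrite ler_ln ?posrE ?ltr0n// ler_nat.
pose om := 4 * C' / (c ^+ 2 * ln a%:R * l) * (4 + (l - ln a%:R)).
have hom k z : (k <= n)%N ->
   E k z (fun p => ((z \notin take (a + a) p) && (z \in p))%:R) <= om.
  exact: late_return_le.
have g0 : (0 < a + a)%N by rewrite addn_gt0 ltnW.
have i0 : 0 <= r2 / l by rewrite divr_ge0// ltW.
have b20 : 0 < eta * (n%:R / l) by rewrite mulr_gt0// divr_gt0.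
have := @range_lower_tail R V N N_gt0 n m K (a + a) y (r2 / l) om eta
  (r1 * (n%:R / l)) (eta * (n%:R / l)) Kmn g0.
rewrite eta0 eta1 => /(_ isT i0 b20 hi hom) /le_trans; apply.
rewrite [leRHS]mulrDl; apply: lerD.
(* The exponential term, at most [exp (- eta^2 l^3 / 2)]. *)
- have Ka : K%:R * (a + a)%:R <= eta * n%:R.
    rewrite natrD -(ler_pM2r KR0).
    have : 4 <= eta * K%:R by rewrite mulrC -ler_pdivrMr// (le_trans L2).
    by move: aK; rewrite expr2; nra.
  have X : r1 * (n%:R / l) + eta * (n%:R / l)
      - (1 - eta) * (K%:R * ((m.+1%:R - (a + a)%:R) * (r2 / l)))
      <= - (eta * (n%:R / l)).
    have -> : (1 - eta) * (K%:R * ((m.+1%:R - (a + a)%:R) * (r2 / l)))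
      = (1 - eta) * r2 / l * (K%:R * m.+1%:R - K%:R * (a + a)%:R) by ring.
    have h1 : (1 - eta) * r2 / l * ((1 - eta) * n%:R) <=
        (1 - eta) * r2 / l * (K%:R * m.+1%:R - K%:R * (a + a)%:R).
      apply: ler_wpM2l; last by lra.
      by rewrite divr_ge0 ?(ltW l1)// mulr_ge0 ?subr_ge0// ltW.
    apply: (@le_trans _ _ (r1 * (n%:R / l) + eta * (n%:R / l)
       - (1 - eta) * r2 / l * ((1 - eta) * n%:R))); first by lra.
    rewrite -subr_ge0.
    have -> : - (eta * (n%:R / l)) - (r1 * (n%:R / l) + eta * (n%:R / l)
       - (1 - eta) * r2 / l * ((1 - eta) * n%:R)) =
      (r2 - r1 - eta * (2 + 2 * r2) + eta ^+ 2 * r2) * (n%:R / l).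
      by field; rewrite gt_eqF.
    rewrite etaE subrr add0r !mulr_ge0 ?exprn_ge0 ?invr_ge0// ?ltW//.
  apply: (@le_trans _ _ (expR (- (eta ^+ 2 * l ^+ 3 / 2)))).
    rewrite ler_expR; apply: (@le_trans _ _ (eta / m.+1%:R * - (eta * (n%:R / l)))).
      by rewrite ler_wpM2l// divr_ge0// ltW.
    rewrite mulrN lerN2.
    have -> : eta / m.+1%:R * (eta * (n%:R / l)) = eta ^+ 2 * n%:R / (m.+1%:R * l).
      by field; rewrite (gt_eqF l1)/= addrC natr1 pnatr_eq0.
    rewrite ler_pdivlMr ?mulr_gt0 ?ltr0n//.
    have -> : eta ^+ 2 * l ^+ 3 / 2 * (m.+1%:R * l)
       = eta ^+ 2 / 2 * (l ^+ 4 * m.+1%:R) by field.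
    rewrite mulrAC -mulrA; apply: ler_wpM2l; first by rewrite exprn_ge0// ltW.
    rewrite ler_pdivrMr// [leRHS]mulrC; apply: le_trans Km2.
    by rewrite ler_wpM2r.
  rewrite expRN.
  have s0 : 0 < s by lra.
  have s30 : 0 < s ^+ 3 by rewrite exprn_gt0.
  have e20 : 0 < eta ^+ 2 by rewrite exprn_gt0.
  have -> : 2 / eta ^+ 2 / s ^+ 3 = (eta ^+ 2 * s ^+ 3 / 2)^-1.
    by field; rewrite !gt_eqF//=; lra.
  rewrite lef_pV2 ?posrE ?expR_gt0 ?divr_gt0 ?mulr_gt0//.
  have sl3 : eta ^+ 2 * s ^+ 3 / 2 <= eta ^+ 2 * l ^+ 3 / 2.
    by rewrite ler_pM2r// ler_pM2l// lerXn2r// ?nnegrE; lra.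
  by apply: le_trans (expR_ge1Dx _); lra.
(* The late returns: [om] is of order [s / l^2], and [s / l = s^(- 3)]. *)
- have n2 : n.+1%:R <= 2 * n%:R :> R.
    by rewrite -natr1 mulrDl mul1r lerD2l ler1n.
  have l2 : 0 < c ^+ 2 * l ^+ 2 by rewrite mulr_gt0 ?exprn_gt0.
  have om_le : om <= 304 * C' * s / (c ^+ 2 * l ^+ 2).
    have den1 : 0 < c ^+ 2 * ln a%:R * l by rewrite !mulr_gt0 ?exprn_gt0.
    rewrite /om mulrAC ler_pdivrMr//.
    have -> : 304 * C' * s / (c ^+ 2 * l ^+ 2) * (c ^+ 2 * ln a%:R * l)
      = 304 * C' * s * ln a%:R / l by field; rewrite !gt_eqF.
    apply: (@le_trans _ _ (4 * C' * (38 * s))).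
      by apply: ler_wpM2l; [rewrite mulr_ge0|lra].
    rewrite ler_pdivlMr//.
    have : 152 * C' * s * l <= 152 * C' * s * (2 * ln a%:R).
      by apply: ler_wpM2l; [rewrite !mulr_ge0//; lra|lra].
    by lra.
  rewrite ler_pdivrMr//.
  apply: (@le_trans _ _ (2 * n%:R * (304 * C' * s / (c ^+ 2 * l ^+ 2)))).
    apply: ler_pM => //.
    by apply: le_trans (hom 0%N y isT); exact: path_mean_ge0.
  rewrite le_eqVlt; apply/orP; left; apply/eqP.
  rewrite -sl; field; rewrite !gt_eqF//; lra.
Qed.

End RangeLowerTail.

Section RangeHalves.
Context (R : realType) (V : choiceType) (N : V -> seq V).
Context (N_gt0 : forall x, (0 < size (N x))%N).
Local Notation E := (@path_mean R V N).

(** Both halves of a path with a small range have a small range; given the first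
    half, the bound [q] applies to the second whatever its starting point. *)
Lemma range_halves n h (b q : R) y : (h + h <= n)%N ->
  (forall z, E h z (fun p => ((range_size (z :: p))%:R <= b)%R%:R) <= q) ->
  E n y (fun p => ((range_size (y :: p))%:R <= b)%R%:R) <= q ^+ 2.
Proof.
move=> /subnKC nE hq; pose A (s : seq V) : R := ((range_size s)%:R <= b)%R%:R.
have A0 s : 0 <= A s by rewrite ler0n.
have q0 : 0 <= q by apply: le_trans (hq y); apply: path_mean_ge0.
have le_A s1 s2 : {subset s1 <= s2} -> A s2 <= A s1.
  move=> s12; rewrite ler_nat; case: (leP _ b) => // h2.
  by rewrite (le_trans _ h2)// ler_nat range_size_le.
apply: (@le_trans _ _ (E (h + h) y (fun p => A (y :: p)))).
  rewrite -[in leLHS]nE -[leRHS](path_mean_take N_gt0 _ (n - (h + h))).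
  apply: path_mean_le => p _ _; apply: le_A => z.
  by rewrite !inE => /orP[->//|/mem_take->]; rewrite orbT.
rewrite path_mean_cat.
apply: (@le_trans _ _ (E h y (fun p => q * A (y :: p)))); last first.
  by rewrite path_meanZ expr2 ler_wpM2l//; exact: hq.
apply: path_mean_le => p sp _; rewrite mulrC.
apply: (le_trans _ (ler_wpM2l (A0 _) (hq (last y p)))).
rewrite -path_meanZ; apply: path_mean_le => r _ _.
have h1 : A (y :: p ++ r) <= A (y :: p).
  by apply: le_A => z; rewrite -cat_cons mem_cat => ->.
have h2 : A (y :: p ++ r) <= A (last y p :: r).
  apply: le_A => z; rewrite inE -cat_cons mem_cat => /orP[/eqP->|->].
    by rewrite mem_last.
  by rewrite orbT.
move: h1 h2; rewrite /A -natrM !ler_nat.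
by case: (_ <= b)%R; case: (_ <= b)%R; case: (_ <= b)%R.
Qed.

(** With half the constant the lower tail is squared: the exponent [3 / 4] of
    [ln n] becomes [3 / 2]. *)
Lemma range_lower_half (r1 r2 : R) : 0 < r1 < r2 ->
  (exists B : R, exists n0, forall n y, (n0 <= n)%N ->
    E n y (fun p => ((range_size (y :: p))%:R <= r2 * (n%:R / ln n%:R))%R%:R)
      <= B / root4 (ln n%:R) ^+ 3) ->
  exists B : R, exists n0, forall n y, (n0 <= n)%N ->
    E n y (fun p => ((range_size (y :: p))%:R <= r1 / 2 * (n%:R / ln n%:R))%R%:R)
      <= B / Num.sqrt (ln n%:R) ^+ 3.
Proof.
move=> /andP[r10 r12] [B [n0 hB]].
have [n1 hn1] := ln_ge_near (Num.max 4 (Num.max n0.*2.+2%:R (r1 / (r2 - r1) + 1))).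
exists (B ^+ 2 * 8), n1 => n y /hn1.
rewrite !ge_max => /andP[l4 /andP[l5 l6]].
have nn0 : 0 < n%:R :> R.
  rewrite ltr0n lt0n; apply/eqP => nE; move: l4; rewrite nE ln0//.
  by rewrite leNgt ltr0n.
have ln_n := ln_sublinear nn0.
pose h := n./2.
have nh : (h + h <= n)%N by rewrite /h; lia.
have nh1 : (n <= h + h + 1)%N by rewrite /h; lia.
have hn0 : (n0 <= h)%N.
  have : (n0.*2.+2 < n)%N by rewrite -(ltr_nat R) (le_lt_trans l5).
  by rewrite /h; lia.
have n4 : (4 < n)%N by rewrite -(ltr_nat R); exact: le_lt_trans ln_n.
have h2 : (1 < h)%N by rewrite /h; lia.
have h0 : (0 < h)%N by exact: ltnW.
have n00 : (0 < n)%N by rewrite -(ltr0n R).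
have hn : (h <= n)%N by exact: leq_trans (leq_addl _ _) nh.
have lh0 : 0 < ln h%:R :> R by rewrite ln_gt0// ltr1n.
have lhn : ln h%:R <= ln n%:R :> R.
  by rewrite ler_ln ?posrE ?ltr0n// ler_nat.
have l0 : 0 < ln n%:R :> R by lra.
have lh4 : ln n%:R / 4 <= ln h%:R :> R.
  have : ln n%:R <= ln (3 * h%:R) :> R.
    have : n%:R <= h%:R + h%:R + 1 :> R by rewrite -natrD natr1 ler_nat -addn1.
    have : 1 < h%:R :> R by rewrite ltr1n.
    by move=> h1 h3; rewrite ler_ln ?posrE; lra.
  rewrite lnM ?posrE ?ltr0n//.
  have : ln 3 <= 2 :> R.
    by have := @le_ln1Dx R 2; rewrite (_ : 1 + 2 = 3); [apply|]; lra.
  by lra.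
have hb : r1 / 2 * (n%:R / ln n%:R) <= r2 * (h%:R / ln h%:R).
  apply: (@le_trans _ _ (r2 * (h%:R / ln n%:R))); last first.
    rewrite ler_pM2l; last by lra.
    by rewrite ler_pM2l ?ltr0n// lef_pV2 ?posrE.
  rewrite !mulrA ler_pM2r ?invr_gt0//.
  have : n%:R <= h%:R + h%:R + 1 :> R by rewrite -natrD natr1 ler_nat -addn1.
  have : r1 / (r2 - r1) <= h%:R + h%:R :> R.
    have : n%:R <= h%:R + h%:R + 1 :> R by rewrite -natrD natr1 ler_nat -addn1.
    by lra.
  rewrite ler_pdivrMr ?subr_gt0//; nra.
have := range_halves y nh (hB h ^~ hn0).
move=> hh; apply: (@le_trans _ _ ((B / root4 (ln h%:R) ^+ 3) ^+ 2)).
  apply: le_trans hh.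
  apply: path_mean_le => p _ _; rewrite ler_nat.
  case: (leP _ (r1 / 2 * _)) => // hp.
  by rewrite (le_trans hp hb).
rewrite expr_div_n -exprM (_ : (3 * 2 = 2 * 3)%N)// exprM sqr_sqrtr ?sqrtr_ge0//.
rewrite -mulrA ler_wpM2l ?sqr_ge0//.
have s4 : Num.sqrt (ln n%:R) / 2 <= Num.sqrt (ln h%:R) :> R.
  have -> : 2 = Num.sqrt 4 :> R.
    by rewrite (_ : 4 = 2 ^+ 2 :> R) ?sqrtr_sqr ?ger0_norm// expr2; lra.
  by rewrite -sqrtrV// -sqrtrM ?(ltW l0)// ler_wsqrtr.
have s0 : 0 < Num.sqrt (ln n%:R) :> R by rewrite sqrtr_gt0.
have sh0 : 0 < Num.sqrt (ln h%:R) :> R by rewrite sqrtr_gt0.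
have : (Num.sqrt (ln n%:R) / 2) ^+ 3 <= Num.sqrt (ln h%:R) ^+ 3 :> R.
  by rewrite lerXn2r// nnegrE ?divr_ge0 ?ltW.
rewrite expr_div_n (_ : 2 ^+ 3 = 8 :> R); last by rewrite !exprS expr0; lra.
rewrite ler_pdivrMr// => s3.
rewrite -[8]invrK -invfM lef_pV2 ?posrE ?exprn_gt0 ?mulr_gt0 ?invr_gt0 ?exprn_gt0//.
by rewrite mulrC ler_pdivrMr.
Qed.

End RangeHalves.

(** * Path means as integrals *)

Section NbrSeq.
Context (V : choiceType) (e : rel V).

(** The neighbours of a vertex, listed without repetition. *)
Definition nbr_seq (v : V) : seq V := enum_fset (fset_set (nbrs e v)).

Lemma nbr_seq_uniq v : uniq (nbr_seq v).
Proof. exact: fset_uniq. Qed.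

Context (hdeg : bounded_degree e).

Lemma mem_nbr_seq v u : (u \in nbr_seq v) = e v u.
Proof.
have [D hD] := hdeg; have fin : finite_set (nbrs e v).
  by apply/finite_set_leP; exists D; exact: hD.
rewrite [LHS]in_fset_set//.
by apply/idP/idP; rewrite inE.
Qed.

Lemma size_nbr_seq : exists D, forall v, (size (nbr_seq v) <= D)%N.
Proof.
have [D hD] := hdeg; exists D => v.
exact: geq_card_fset_set (hD v).
Qed.

Context (hinf : infinite_set [set: V]) (hconn : connected_graph e).

Lemma nbr_seq_gt0 v : (0 < size (nbr_seq v))%N.
Proof.
have [u uv] : exists u, u != v.
  apply: contrapT => /forallNP h; apply: hinf.
  apply: (sub_finite_set _ (finite_set1 v)) => u _ /=.
  by apply/eqP; apply: contra_notT (h u).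
have [p [vp lp]] := hconn v u.
case: p vp lp => [_ /= vu|z p /= /andP[vz _] _]; first by rewrite vu eqxx in uv.
by move: vz; rewrite -mem_nbr_seq; case: (nbr_seq v).
Qed.

Lemma vertex_countable (x : V) : countable [set: V].
Proof.
have -> : [set: V] =
    \bigcup_n [set` [seq last x p | p <- npaths nbr_seq n x]].
  apply/seteqP; split => // v _.
  have [p [xp lp]] := hconn x v.
  exists (size p) => //=; rewrite -lp; apply/map_f.
  rewrite npathsP eqxx /=; apply: sub_path xp => a b.
  by rewrite /nbr mem_nbr_seq.
apply: bigcup_countable => // n _.
exact/finite_set_countable/finite_seq.
Qed.

End NbrSeq.

Section WalkLaw.
Context (R : realType) (V : choiceType) (e : rel V).
Context (hdeg : bounded_degree e) (hinf : infinite_set [set: V]).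
Context (hconn : connected_graph e).
Context (d : measure_display) (Omega : measurableType d).
Context (P : V -> probability Omega R) (S : nat -> Omega -> V).
Context (hwalk : simple_random_walk e P S).
Local Notation N := (nbr_seq e).

(** The path [S_0, ..., S_n]. *)
Definition trajectory n w : seq V := [seq S k w | k <- iota 0 n.+1].

Lemma trajectoryS n w : trajectory n.+1 w = rcons (trajectory n w) (S n.+1 w).
Proof. by rewrite /trajectory -[in LHS]addn1 iotaD map_cat cats1 add0n. Qed.

(** No hypothesis on [Q] is needed, as there are countably many vertices. *)
Lemma measurable_trajectory n (Q : set (seq V)) :
  measurable [set w | Q (trajectory n w)].
Proof.
have [mS _ _] := hwalk.
have [[x _]|noV] := pselect (exists x : V, True); last first.
  rewrite (_ : [set w | _] = set0)//; apply/seteqP; split => // w _ /=.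
  by apply: noV; exists (S 0%N w).
have cV := vertex_countable hdeg hconn x.
elim: n Q => [|n IH] Q.
  have -> : [set w | Q (trajectory 0 w)] =
      \bigcup_v ([set w | S 0%N w = v /\ Q [:: v]]).
    apply/seteqP; split => [w Qw|w [v _ [<-]]] //.
    by exists (S 0%N w).
  apply: countable_bigcupT_measurable => // v.
  have [Qv|Qv] := pselect (Q [:: v]).
    rewrite (_ : [set w | _] = [set w | S 0%N w = v])//.
    by apply/seteqP; split => w; [case|split].
  by rewrite (_ : [set w | _] = set0)//; apply/seteqP; split => w // [].
have -> : [set w | Q (trajectory n.+1 w)] =
    \bigcup_v ([set w | S n.+1 w = v] `&` [set w | Q (rcons (trajectory n w) v)]).
  apply/seteqP; split => [w|w [v _ [/= <-]]]; rewrite /= trajectoryS// => Qw.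
  by exists (S n.+1 w).
apply: countable_bigcupT_measurable => // v; apply: measurableI => //.
exact: (IH [set p | Q (rcons p v)]).
Qed.

Lemma path_weight_rcons (x y : V) p :
  path_weight R N x (rcons p y)
  = path_weight R N x p * step R e (last x p) y.
Proof.
elim: p x => [|z p IH] x /=; last by rewrite IH mulrA.
by rewrite mulr1 mul1r /step mem_nbr_seq.
Qed.

Lemma trajectory_law n x p : size p = n ->
  P x [set w | trajectory n w = x :: p] = (path_weight R N x p)%:E.
Proof.
have [mS S0 SM] := hwalk.
have trE m (q : seq V) w : size q = m -> trajectory m w = x :: q <->
    (forall k, (k <= m)%N -> S k w = nth x (x :: q) k).
  move=> sq; split => [tr k km|tr].
    by rewrite -tr (nth_map 0%N) ?size_iota// nth_iota.
  apply: (@eq_from_nth _ x); rewrite ?size_map ?size_iota /= ?sq// => k km.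
  by rewrite (nth_map 0%N) ?size_iota// nth_iota// -tr.
elim: n p => [|n IH] p sp.
  rewrite (size0nil sp) /= -(S0 x); congr (P x _).
  by apply/seteqP; split => w /=; [case|rewrite /trajectory /= => ->].
case: (lastP p) sp => [//|{}p y]; rewrite size_rcons => -[sp].
have -> : [set w | trajectory n.+1 w = x :: rcons p y] =
   [set w | forall k, (k <= n.+1)%N -> S k w = nth x (x :: rcons p y) k].
  by apply/seteqP; split => w /=; rewrite trE// size_rcons sp.
rewrite SM.
have -> : [set w | forall k, (k <= n)%N -> S k w = nth x (x :: rcons p y) k] =
   [set w | trajectory n w = x :: p].
  apply/seteqP; split => w /=; rewrite trE// => tr k kn; rewrite tr//;
  by rewrite -rcons_cons nth_rcons /= sp ltnS kn.
rewrite IH// path_weight_rcons EFinM; congr (_ * (step _ _ _ _)%:E)%E.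
  by rewrite -rcons_cons nth_rcons /= sp ltnS leqnn -{1}sp -last_nth.
by rewrite /= nth_rcons sp ltnn eqxx.
Qed.

(** The expectation of a nonnegative functional of the trajectory is a path
    mean. *)
Lemma integral_trajectory n x (f : seq V -> R) : (forall s, 0 <= f s) ->
  (\int[P x]_w (f (trajectory n w))%:E)%E
  = (path_mean N n x (fun p => f (x :: p)))%:E.
Proof.
move=> f0; pose F := npaths N n x.
pose A p := [set w | trajectory n w = x :: p].
have mA p : measurable (A p).
  exact: (measurable_trajectory n [set s | s = x :: p]).
have uF : uniq F by apply: npaths_uniq => y; exact: nbr_seq_uniq.
have PA p : p \in F -> P x (A p) = (path_weight R N x p)%:E.
  by rewrite npathsP => /andP[/eqP sp _]; exact: trajectory_law.
(* The trajectory is almost surely [x :: p] for some [p] in [F], since the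
   weights of these paths add up to [1]. *)
pose g w : \bar R := (\sum_(p <- F) (f (x :: p) * \1_(A p) w)%:E)%E.
have PG : P x (\bigcup_(p in [set` F]) A p) = 1%E.
  rewrite measure_fin_bigcup//=; first last.
  - move=> p q _ _ [w []]; rewrite /A /= => -> [].
    by [].
  rewrite -fsbig_seq// big_seq (eq_bigr _ PA) -big_seq sumEFin.
  rewrite -(path_mean_cst (nbr_seq_gt0 hdeg hinf hconn) n x 1) path_mean_npaths.
  by congr EFin; apply: eq_bigr => p _; rewrite mulr1.
have mg p : measurable_fun [set: Omega]
    (fun w => (f (x :: p) * \1_(A p) w)%:E).
  by apply/measurable_EFinP; apply: measurable_funM => //; exact: measurable_indic.
rewrite (ge0_ae_eq_integral (g := g))//=.
- rewrite ge0_integral_sum//; last first.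
    by move=> p w _; rewrite lee_fin mulr_ge0.
  rewrite path_mean_npaths -sumEFin big_seq [RHS]big_seq; apply: eq_bigr => p pF.
  under eq_integral do rewrite EFinM.
  rewrite ge0_integralZl//; first last.
  - by rewrite lee_fin.
  - by apply/measurable_EFinP; exact: measurable_indic.
  rewrite integral_indic// setIT [RHS]EFinM muleC.
  by congr (_ * _)%E; exact: (PA p pF).
- apply/measurable_EFinP => _ Y mY; rewrite setTI.
  exact: (measurable_trajectory n [set s | Y (f s)]).
- exact: emeasurable_fun_sum.
- by move=> w _; rewrite lee_fin.
- by move=> w _; apply: sume_ge0 => p _; rewrite lee_fin mulr_ge0.
- exists (~` \bigcup_(p in [set` F]) A p); split.
  + by apply: measurableC; apply: fin_bigcup_measurable => // p _; exact: mA.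
  + apply: etrans (probability_setC (P x) _) _.
      by apply: fin_bigcup_measurable => // p _; exact: mA.
    by rewrite PG subee.
  + move=> w /= h [p pF Ap]; apply: h => _.
    rewrite /g (bigD1_seq p)//= big1 ?adde0.
      by rewrite indicE mem_set// mulr1 Ap.
    move=> q qp; rewrite indicE memNset ?mulr0// /A /= Ap => -[pq].
    by rewrite pq eqxx in qp.
Qed.

Lemma probability_trajectory n x (Q : pred (seq V)) :
  P x [set w | Q (trajectory n w)]
  = (path_mean N n x (fun p => (Q (x :: p))%:R))%:E.
Proof.
rewrite -(integral_trajectory n x (f := fun s => (Q s)%:R))//.
have mQ : measurable [set w | Q (trajectory n w)].
  exact: (measurable_trajectory n [set s | Q s]).
rewrite -[X in P x X]setIT -integral_indic//.
by apply: eq_integral => w _; rewrite indicE mem_setE.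
Qed.

End WalkLaw.

(** * Limits superior and inferior, and the Borel-Cantelli lemma *)

Section ExtendedLimits.
Context (R : realType).
Implicit Types (u : nat -> \bar R) (a b : \bar R).
Local Open Scope ereal_scope.

Lemma limn_esup_le_near u a :
  (exists n0, forall n, (n0 <= n)%N -> u n <= a) -> limn_esup u <= a.
Proof.
move=> [n0 hu]; apply: (@le_trans _ _ (ereal_sup (u @` [set n | (n0 <= n)%N]))).
  by apply: ereal_inf_lbound; exists [set n | (n0 <= n)%N] => //; exists n0.
by apply: ge_ereal_sup => _ [n /= n0n <-]; exact: hu.
Qed.

Lemma limn_esup_lt_near u a : limn_esup u < a ->
  exists n0, forall n, (n0 <= n)%N -> u n <= a.
Proof.
move=> /ereal_inf_lt[_ [A [n0 _ hA] <-]] supA; exists n0 => n n0n.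
apply: le_trans (ltW supA); apply: ereal_sup_ubound; exists n => //.
exact: hA.
Qed.

Lemma limn_einf_ge_near u a :
  (exists n0, forall n, (n0 <= n)%N -> a <= u n) -> a <= limn_einf u.
Proof.
move=> [n0 hu]; rewrite leeNr; apply: limn_esup_le_near.
by exists n0 => n n0n /=; rewrite leeN2 hu.
Qed.

Lemma limn_einf_gt_near u a : a < limn_einf u ->
  exists n0, forall n, (n0 <= n)%N -> a <= u n.
Proof.
rewrite lteNr => /limn_esup_lt_near[n0 hu]; exists n0 => n /hu /=.
by rewrite leeN2.
Qed.

Lemma lee_lt_real (r : R) b :
  (forall t : R, (t < r)%R -> t%:E <= b) -> r%:E <= b.
Proof.
move=> h; apply/lee_addgt0Pr => t t0; rewrite -leeBlDr//.
by rewrite -EFinB; apply: h; rewrite ltrBlDr ltrDl.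
Qed.

Lemma lee_gt_real (r : R) b :
  (forall t : R, (r < t)%R -> b <= t%:E) -> b <= r%:E.
Proof.
by move=> h; apply/lee_addgt0Pr => t t0; rewrite -EFinD; apply: h; rewrite ltrDl.
Qed.

End ExtendedLimits.

Section BorelCantelli.
Context (R : realType).

Lemma inv_sqrt3_le (c : R) : 0 < c ->
  (Num.sqrt (c + 1) ^+ 3)^-1 <= 2 / Num.sqrt c - 2 / Num.sqrt (c + 1).
Proof.
move=> c0; have c10 : 0 < c + 1 by rewrite addr_gt0.
have a0 : 0 < Num.sqrt c by rewrite sqrtr_gt0.
have b0 : 0 < Num.sqrt (c + 1) by rewrite sqrtr_gt0.
have aE : Num.sqrt c ^+ 2 = c by rewrite sqr_sqrtr// ltW.
have bE : Num.sqrt (c + 1) ^+ 2 = c + 1 by rewrite sqr_sqrtr// ltW.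
have ab : Num.sqrt c <= Num.sqrt (c + 1) by rewrite ler_wsqrtr// lerDl.
move: (Num.sqrt c) (Num.sqrt (c + 1)) a0 b0 aE bE ab => a b a0 b0 aE bE ab.
have ba : (b - a) * (b + a) = 1 by rewrite -subr_sqr aE bE; ring.
rewrite -subr_ge0.
have -> : 2 / a - 2 / b - (b ^+ 3)^-1
   = (2 * b ^+ 2 * (b - a) - a) / (a * b ^+ 3).
  by field; rewrite !gt_eqF.
apply: divr_ge0; last by rewrite mulr_ge0 ?exprn_ge0 ?ltW.
rewrite subr_ge0 -(@ler_pM2r _ (b + a)) ?addr_gt0//.
rewrite -[leRHS]mulrA ba mulr1 expr2.
by nra.
Qed.

(** A summable sequence: the sums are dominated by [3 - 2 / sqrt n]. *)
Lemma sum_inv_sqrt3_le m : \sum_(k < m) (Num.sqrt k%:R ^+ 3)^-1 <= 3 :> R.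
Proof.
case: m => [|[|m]]; first by rewrite big_ord0.
  by rewrite big_ord1 sqrtr0 expr0n invr0.
apply: (@le_trans _ _ (3 - 2 / Num.sqrt m.+1%:R)); last first.
  by rewrite gerBl divr_ge0// sqrtr_ge0.
elim: m => [|m IH].
  rewrite !big_ord_recr big_ord0 /= sqrtr0 sqrtr1 expr0n expr1n invr0 invr1.
  by lra.
rewrite big_ord_recr /=; apply: le_trans (lerD IH (lexx _)) _.
rewrite -[m.+2%:R]natr1; have := inv_sqrt3_le (ltr0Sn R m); lra.
Qed.

(** The Borel-Cantelli lemma for probabilities of order [n^(- 3 / 2)]. *)
Lemma borel_cantelli_le d (T : measurableType d) (mu : {measure set T -> \bar R})
    (A : nat -> set T) (B : R) n0 :
  (forall n, measurable (A n)) ->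
  (forall n, (n0 <= n)%N -> (mu (A n) <= (B / Num.sqrt n%:R ^+ 3)%:E)%E) ->
  \forall w \ae mu, exists n1, forall n, (n1 <= n)%N -> ~ A n w.
Proof.
move=> mA hA; pose F n := A (n + n0)%N.
have sumF : (\sum_(n <oo) mu (F n) < +oo)%E.
  apply: (@le_lt_trans _ _ (`|B| * 3)%:E); last exact: ltry.
  apply: lime_le; first exact: is_cvg_nneseries.
  apply: nearW => m; rewrite big_mkord.
  apply: (@le_trans _ _ (\sum_(k < m) (`|B| * (Num.sqrt (k + n0)%:R ^+ 3)^-1)%:E)%E).
    apply: lee_sum => k _; apply: le_trans (hA _ (leq_addl _ _)) _.
    by rewrite lee_fin ler_wpM2r ?ler_norm// invr_ge0 exprn_ge0// sqrtr_ge0.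
  rewrite sumEFin lee_fin -mulr_sumr ler_wpM2l//.
  apply: le_trans (sum_inv_sqrt3_le (n0 + m)).
  rewrite big_split_ord /=; apply: ler_wpDl.
    by apply: sumr_ge0 => k _; rewrite invr_ge0 exprn_ge0// sqrtr_ge0.
  by apply: ler_sum => k _; rewrite addnC.
exists (lim_sup_set F); split.
- apply: bigcapT_measurable => k; apply: bigcup_measurable => j _; exact: mA.
- by apply: lim_sup_set_cvg0 => // k; exact: mA.
- move=> w /= h k _; apply: contrapT => hk; apply: h.
  exists (k + n0)%N => n kn An; apply: hk; exists (n - n0)%N => /=; first by lia.
  by rewrite /F subnK//; lia.
Qed.

End BorelCantelli.

(** * The range of the walk *)

Section Interpolation.
Context (R : realType) (del : R) (del0 : 0 < del).

(** The time [n_k], the integer part of [exp (del k)]. *)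
Definition geo_time k : nat := Num.truncn (expR (del * k%:R)).

Lemma ln_geo_time_ge k : 2 / del <= k%:R -> del * k%:R / 2 <= ln (geo_time k)%:R.
Proof.
rewrite ler_pdivrMr// => hk.
have e0 := expR_gt0 (del * k%:R).
have g1 : 1 <= expR (del * k%:R).
  by rewrite -[leLHS]expR0 ler_expR; lra.
have : expR (del * k%:R) < (geo_time k).+1%:R by exact: truncnS_gt.
have : 1 <= (geo_time k)%:R :> R by rewrite ler1n truncn_gt0.
rewrite -natr1; move: (geo_time k)%:R => g g1' ge.
rewrite -[leLHS]expRK ler_ln ?posrE ?expR_gt0//; last by lra.
rewrite -[leLHS]mulr1 -(@ler_pM2l _ 2)//.
set b := expR _; have b0 : 0 < b by exact: expR_gt0.
have bb : expR (del * k%:R) = b * b.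
  by rewrite -expRD; congr expR; field.
have b2 : 2 <= b.
  by apply: le_trans (expR_ge1Dx _); lra.
by rewrite bb in ge; nra.
Qed.

(** For [k] the integer part of [ln n / del], [a n >= a n_k], and [n_k + 1] is at least
    [n exp (- del)], hence at least [n (1 - del)]. *)
Lemma geo_interpolation (r r' : R) (a : nat -> nat) :
  0 < r < r' -> del <= (r' - r) / (2 * r') ->
  {homo a : m n / (m <= n)%N} ->
  (exists k0, forall k, (k0 <= k)%N ->
     r' * ((geo_time k)%:R / ln (geo_time k)%:R) <= (a (geo_time k))%:R) ->
  exists n0, forall n, (n0 <= n)%N -> r * (n%:R / ln n%:R) <= (a n)%:R.
Proof.
move=> /andP[r0 rr'] hdel ma [k0 hk].
have r'0 : 0 < r' by exact: lt_trans rr'.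
have [n0 hn0] := ln_ge_near (Num.max (del * (k0.+1%:R + 2 / del + 2)) (2 * r' / (r' - r))).
exists n0 => n /hn0; rewrite ge_max => /andP[l1 l2].
pose k := Num.truncn (ln n%:R / del).
have l0 : 0 < ln n%:R :> R.
  by apply: lt_le_trans l2; rewrite divr_gt0 ?subr_gt0 ?mulr_gt0.
have nR0 : 0 < n%:R :> R.
  rewrite ltr0n lt0n; apply/eqP => nE; move: l0; rewrite nE ln0//.
  by rewrite ltxx.
have ln_n := ln_sublinear nR0.
have /andP[kl ku] : k%:R <= ln n%:R / del < k.+1%:R.
  by apply: truncn_itv; apply: divr_ge0; exact: ltW.
have l1' : k0.+1%:R + 2 / del + 2 <= ln n%:R / del.
  by rewrite ler_pdivlMr// mulrC.
have d20 : 0 < 2 / del by rewrite divr_gt0.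
have k0R := ler0n R k0.
have hk0 : (k0 <= k)%N.
  by rewrite -(ler_nat R); move: ku l1'; rewrite -!natr1; lra.
have k2 : 2 / del <= k%:R by move: ku l1'; rewrite -!natr1; lra.
have kn : (geo_time k <= n)%N.
  rewrite -(ler_nat R).
  apply: (@le_trans _ _ (expR (del * k%:R))); first by rewrite truncn_le expR_ge0.
  by rewrite -[leRHS]lnK ?posrE// ler_expR mulrC -ler_pdivlMr.
have nk : n%:R * (1 - del) <= (geo_time k)%:R + 1.
  have : expR (del * k%:R) < (geo_time k).+1%:R by exact: truncnS_gt.
  rewrite -natr1 => /ltW; apply: le_trans.
  apply: (@le_trans _ _ (n%:R * expR (- del))).
    by rewrite ler_wpM2l// expR_ge1Dx.
  rewrite -[X in X * _](lnK (x := n%:R)) ?posrE// -expRD ler_expR lerBlDr.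
  rewrite -[X in _ + X]mulr1 -mulrDr natr1 -ler_pdivrMl// mulrC.
  exact: ltW.
have lk : del * k%:R / 2 <= ln (geo_time k)%:R by exact: ln_geo_time_ge.
have lk0 : 0 < ln (geo_time k)%:R :> R.
  by apply: lt_le_trans lk; rewrite divr_gt0// mulr_gt0// (lt_le_trans d20).
have g0 : (0 < geo_time k)%N.
  by rewrite lt0n; apply/eqP => gE; move: lk0; rewrite gE ln0// ltxx.
apply: (@le_trans _ _ (a (geo_time k))%:R); last by rewrite ler_nat ma.
apply: le_trans (hk k hk0).
apply: (@le_trans _ _ (r' * ((geo_time k)%:R / ln n%:R))); last first.
  rewrite ler_pM2l// ler_pM2l ?ltr0n// lef_pV2 ?posrE//.
  by rewrite ler_ln ?posrE ?ler_nat // ltr0n.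
rewrite !mulrA ler_pM2r ?invr_gt0//.
have : del * (2 * r') <= r' - r by rewrite -ler_pdivlMr// mulr_gt0.
have : 2 * r' <= n%:R * (r' - r).
  by rewrite -ler_pdivrMr ?subr_gt0//; apply: le_trans l2 _; exact: ltW.
have : n%:R * (1 - del) * r' <= ((geo_time k)%:R + 1) * r' by rewrite ler_pM2r.
move: (geo_time k)%:R => g h1 h2 h3.
have : n%:R * (del * (2 * r')) <= n%:R * (r' - r) by rewrite ler_pM2l.
by lra.
Qed.

End Interpolation.

Section WalkRange.
Context (R : realType) (V : choiceType) (e : rel V).
Context (hsimple : simple_graph e) (hinf : infinite_set [set: V]).
Context (hconn : connected_graph e) (hdeg : bounded_degree e).
Context (d : measure_display) (Omega : measurableType d).
Context (P : V -> probability Omega R) (S : nat -> Omega -> V).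
Context (hwalk : simple_random_walk e P S).
Local Notation N := (nbr_seq e).
Local Notation E := (@path_mean R V N).
Local Notation escape := (@escape R V N).

Let N_gt0 := nbr_seq_gt0 hdeg hinf hconn.

Lemma walk_rangeE n w : walk_range S n w = range_size (trajectory S n w).
Proof. by rewrite -size_undup_range. Qed.

Lemma walk_range_homo w : {homo (fun n => walk_range S n w) : m n / (m <= n)%N}.
Proof.
move=> m n mn /=; rewrite !walk_rangeE; apply: range_size_le => z /mapP[k km ->].
by apply/map_f; move: km; rewrite !mem_iota; lia.
Qed.

Lemma heat_kernelE n x y : heat_kernel P S n x y = kernel R N n x y.
Proof.
rewrite /heat_kernel.
have -> : [set w | S n w = y] = [set w | last y (trajectory S n w) == y].
  have lastE w : last y (trajectory S n w) = S n w.
    by case: n => [//|n]; rewrite trajectoryS last_rcons.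
  by apply/seteqP; split => w; rewrite /mkset lastE => /eqP.
by rewrite (probability_trajectory hdeg hinf hconn hwalk n x (fun s => last y s == y)).
Qed.

Lemma escape_probE n x : escape_prob P S n x = (escape n x)%:E.
Proof.
rewrite /escape_prob.
have -> : [set w | (n%:R%:E < hitting_time R S x w)%E] =
    [set w | x \notin behead (trajectory S n w)].
  apply/seteqP; split => w /=.
    move=> nT; apply/negP => /mapP[k]; rewrite mem_iota => /andP[k1 kn] xk.
    move: nT; rewrite ltNge => /negP; apply.
    apply: (@le_trans _ _ k%:R%:E); last by rewrite lee_fin ler_nat; lia.
    by apply: ereal_inf_lbound; exists k.
  move=> xS; apply: (@lt_le_trans _ _ n.+1%:R%:E).
    by rewrite lte_fin ltr_nat.
  apply: le_ereal_inf_tmp => _ [k [k1 kx] <-]; rewrite lee_fin ler_nat ltnNge.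
  apply: contra xS => kn; apply/mapP; exists k => //.
  by rewrite mem_iota; lia.
by rewrite (probability_trajectory hdeg hinf hconn hwalk n x (fun s => x \notin behead s)).
Qed.

Lemma measurable_range_le n (b : R) :
  measurable [set w | (walk_range S n w)%:R <= b].
Proof.
have := measurable_trajectory hdeg hconn hwalk n [set s | (range_size s)%:R <= b].
by congr measurable; apply/seteqP; split => w /=; rewrite walk_rangeE.
Qed.

Lemma measurable_range_ge n (b : R) :
  measurable [set w | b <= (walk_range S n w)%:R].
Proof.
have := measurable_trajectory hdeg hconn hwalk n [set s | b <= (range_size s)%:R].
by congr measurable; apply/seteqP; split => w /=; rewrite walk_rangeE.
Qed.

Lemma probability_range_le n x (b : R) :
  P x [set w | (walk_range S n w)%:R <= b] =
  (E n x (fun p => ((range_size (x :: p))%:R <= b)%R%:R))%:E.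
Proof.
rewrite -(probability_trajectory hdeg hinf hconn hwalk n x
  (fun s => (range_size s)%:R <= b)).
by congr (P x _); apply/seteqP; split => w /=; rewrite walk_rangeE.
Qed.

Lemma probability_range_ge n x (b : R) :
  P x [set w | b <= (walk_range S n w)%:R] =
  (E n x (fun p => (b <= (range_size (x :: p))%:R)%R%:R))%:E.
Proof.
rewrite -(probability_trajectory hdeg hinf hconn hwalk n x
  (fun s => b <= (range_size s)%:R)).
by congr (P x _); apply/seteqP; split => w /=; rewrite walk_rangeE.
Qed.

Lemma expectation_range n x :
  ('E_(P x)[fun w => (walk_range S n w)%:R]
   = (E n x (fun p => (range_size (x :: p))%:R))%:E)%E.
Proof.
rewrite unlock -(integral_trajectory hdeg hinf hconn hwalk n x
  (f := fun s => (range_size s)%:R))//.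
by apply: eq_integral => w _; rewrite walk_rangeE.
Qed.

Lemma r_inf_gt_near (r : R) : (r%:E < r_inf P S)%E ->
  exists n0, forall n y, (n0 <= n)%N -> r <= ln n%:R * escape n y.
Proof.
move=> /limn_einf_gt_near[n0 hn]; exists n0.+1 => n y n0n.
rewrite -lee_fin; apply: le_trans (hn n (ltnW n0n)) _.
rewrite EFinM -escape_probE; apply: lee_wpmul2l.
  by rewrite lee_fin ln_ge0// ler1n; lia.
by apply: ereal_inf_lbound; exists y.
Qed.

Lemma r_sup_lt_near (r : R) : (r_sup P S < r%:E)%E ->
  exists n0, forall n y, (n0 <= n)%N -> ln n%:R * escape n y <= r.
Proof.
move=> /limn_esup_lt_near[n0 hn]; exists n0.+1 => n y n0n.
rewrite -lee_fin; apply: le_trans (hn n (ltnW n0n)).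
rewrite EFinM -escape_probE; apply: lee_wpmul2l.
  by rewrite lee_fin ln_ge0// ler1n; lia.
by apply: ereal_sup_ubound; exists y.
Qed.

Lemma r_inf_ge0 : (0 <= r_inf P S)%E.
Proof.
apply: limn_einf_ge_near; exists 1%N => n n1; apply: mule_ge0.
  by rewrite lee_fin ln_ge0// ler1n.
by apply: le_ereal_inf_tmp => _ [y _ <-]; exact: measure_ge0.
Qed.

Lemma r_sup_ge0 (x : V) : (0 <= r_sup P S)%E.
Proof.
apply: (@le_trans _ _ (limn_einf
    (fun n => (ln n%:R)%:E * ereal_sup (range (escape_prob P S n)))%E));
  last exact: limn_einf_sup.
apply: limn_einf_ge_near; exists 1%N => n n1; apply: mule_ge0.
  by rewrite lee_fin ln_ge0// ler1n.
apply: (@le_trans _ _ (escape_prob P S n x)); first exact: measure_ge0.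
by apply: ereal_sup_ubound; exists x.
Qed.

Context (hrec : uniformly_weakly_recurrent P S).

Lemma kernel_diag : exists c C : R, 0 < c /\
  forall n x, (1 <= n)%N ->
    c <= n%:R * (kernel R N n x x + kernel R N n.+1 x x) <= C.
Proof.
have [c [C [c0 _ h]]] := hrec; exists c, C; split => // n x n1.
by rewrite -!heat_kernelE; exact: h.
Qed.

Lemma nbr_seq_sym x y : (y \in N x) = (x \in N y).
Proof. by rewrite !mem_nbr_seq//; case: hsimple => sym _; rewrite sym. Qed.

(** The limit inferior is finite because the escape probabilities are at most
    of order [1 / ln n]; otherwise [r_inf - eps] would be infinite as well. *)
Lemma r_inf_fin (x : V) : r_inf P S \is a fin_num.
Proof.
have [c [C [c0 diag]]] := kernel_diag.
rewrite ge0_fin_numE ?r_inf_ge0//; apply: le_lt_trans (ltry (2 / c)).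
apply: (le_trans (limn_einf_sup _)); apply: limn_esup_le_near.
exists 2%N => n n2; have l0 : 0 < ln n%:R :> R by rewrite ln_gt0// ltr1n.
apply: (@le_trans _ _ ((ln n%:R)%:E * escape_prob P S n x)%E).
  apply: lee_wpmul2l; first by rewrite lee_fin ltW.
  by apply: ereal_inf_lbound; exists x.
rewrite escape_probE -EFinM lee_fin.
have := escape_le_ln N_gt0 c0 diag x n2.
move=> /(ler_wpM2l (ltW l0)) /le_trans; apply.
rewrite le_eqVlt; apply/orP; left; apply/eqP; field.
by rewrite !gt_eqF.
Qed.

Lemma range_scale_le n w (r : R) : (1 < n)%N ->
  ((walk_range S n w)%:R / scale R n <= r)
  = ((walk_range S n w)%:R <= r * (n%:R / ln n%:R)).
Proof.
move=> n1; rewrite ler_pdivrMr//; apply: divr_gt0; last by rewrite ln_gt0// ltr1n.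
by rewrite ltr0n ltnW.
Qed.

Lemma range_scale_ge n w (r : R) : (1 < n)%N ->
  (r <= (walk_range S n w)%:R / scale R n)
  = (r * (n%:R / ln n%:R) <= (walk_range S n w)%:R).
Proof.
move=> n1; rewrite ler_pdivlMr//; apply: divr_gt0; last by rewrite ln_gt0// ltr1n.
by rewrite ltr0n ltnW.
Qed.

Lemma range_scale_ge0 n w : 0 <= (walk_range S n w)%:R / scale R n.
Proof.
case: n => [|n]; first by rewrite /scale mul0r invr0 mulr0.
by rewrite divr_ge0// divr_ge0// ln_ge0// ler1n.
Qed.

Lemma mean_range_scale n x : ('E_(P x)[fun w => (walk_range S n w)%:R]
    * ((scale R n)^-1)%:E
   = (E n x (fun p => (range_size (x :: p))%:R) / scale R n)%:E)%E.
Proof. by rewrite expectation_range. Qed.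

Lemma range_liminf_mean x : (r_inf P S <=
  limn_einf (fun n => 'E_(P x)[fun w => (walk_range S n w)%:R]
                        * ((scale R n)^-1)%:E))%E.
Proof.
rewrite -(fineK (r_inf_fin x)); apply: lee_lt_real => r hr.
have [n0 hn] : exists n0, forall n y, (n0 <= n)%N -> r <= ln n%:R * escape n y.
  by apply: r_inf_gt_near; rewrite -(fineK (r_inf_fin x)) lte_fin.
apply: limn_einf_ge_near; exists n0.+2 => n n0n.
rewrite mean_range_scale lee_fin.
have l0 : 0 < ln n%:R :> R by rewrite ln_gt0// ltr1n; lia.
have nR0 : 0 < n%:R :> R by rewrite ltr0n; lia.
have [r0|r0] := ltP r 0.
  apply: (le_trans (ltW r0)); apply: divr_ge0; last by rewrite divr_ge0// ltW.
  exact: path_mean_ge0.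
rewrite ler_pdivlMr ?divr_gt0//.
have hi z : r / ln n%:R <= escape n z.
  by rewrite ler_pdivrMr// mulrC hn//; lia.
apply: le_trans (mean_range_ge N_gt0 x hi).
rewrite mulrCA ler_wpM2r//; first by rewrite divr_ge0// ltW.
by rewrite ler_nat.
Qed.

Lemma range_limsup_mean x : (limn_esup (fun n =>
   'E_(P x)[fun w => (walk_range S n w)%:R] * ((scale R n)^-1)%:E)
  <= r_sup P S)%E.
Proof.
have s0 := r_sup_ge0 x.
case sE : (r_sup P S) s0 => [s| |] // s0; last by rewrite leey.
apply: lee_gt_real => r sr; rewrite lee_fin in s0.
pose r0 := (s + r) / 2.
have [sr0 r0r] : s < r0 /\ r0 < r by rewrite /r0; split; lra.
have r01 : 0 <= r0 < r by rewrite r0r andbT; lra.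
have hesc : exists n0, forall n y, (n0 <= n)%N -> ln n%:R * escape n y <= r0.
  by apply: r_sup_lt_near; rewrite sE lte_fin.
have [n0 hn] := mean_range_upper_le N_gt0 r01 hesc.
apply: limn_esup_le_near; exists n0.+2 => n n0n.
rewrite mean_range_scale lee_fin.
have l0 : 0 < ln n%:R :> R by rewrite ln_gt0// ltr1n; lia.
have nR0 : 0 < n%:R :> R by rewrite ltr0n; lia.
by rewrite ler_pdivrMr ?divr_gt0//; apply: hn; lia.
Qed.

Lemma range_limsup x : \forall w \ae P x,
  (limn_esup (fun n => ((walk_range S n w)%:R / scale R n)%:E) <= r_sup P S)%E.
Proof.
have s0 := r_sup_ge0 x.
case sE : (r_sup P S) s0 => [s| |] // s0; last first.
  by apply: aeW => w; rewrite leey.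
rewrite lee_fin in s0.
have near_le t : 0 < t -> \forall w \ae P x, (limn_esup (fun n =>
    ((walk_range S n w)%:R / scale R n)%:E) <= (s + t)%:E)%E.
  move=> t0; pose r := s + t; pose r0 := (s + r) / 2.
  have [sr0 r0r] : s < r0 /\ r0 < r by rewrite /r0 /r; split; lra.
  have r01 : 0 <= r0 < r by rewrite r0r andbT; lra.
  have hesc : exists n0, forall n y, (n0 <= n)%N -> ln n%:R * escape n y <= r0.
    by apply: r_sup_lt_near; rewrite sE lte_fin.
  have [n0 hn] := range_upper_le N_gt0 r01 hesc.
  pose A n := [set w | r * (n%:R / ln n%:R) <= (walk_range S n w)%:R].
  have := @borel_cantelli_le R _ Omega (P x) A 1 n0.+1.
  have mA n : measurable (A n) by exact: measurable_range_ge.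
  have PA n : (n0 < n)%N -> (P x (A n) <= (1 / Num.sqrt n%:R ^+ 3)%:E)%E.
    move=> n0n; rewrite probability_range_ge lee_fin.
    apply: le_trans (hn n x (ltnW n0n)) _; rewrite mul1r.
    have n1 : 1 <= n%:R :> R by rewrite ler1n; lia.
    have q1 : 1 <= Num.sqrt n%:R :> R by rewrite -[leLHS]sqrtr1 ler_wsqrtr.
    rewrite lef_pV2 ?posrE ?exprn_gt0//; try by lra.
    rewrite -[in leRHS](sqr_sqrtr (ler0n R n)) -exprM.
    by rewrite ler_weXn2l.
  move=> /(_ mA PA); apply: filterS => w [n1 hw].
  apply: limn_esup_le_near; exists (maxn n1 2) => n; rewrite geq_max => /andP[n1n n2].
  rewrite lee_fin range_scale_le// ltW// ltNge; apply/negP.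
  exact: hw.
have near_inv (j : nat) := near_le _ (etrans (invr_gt0 _) (ltr0Sn R j)).
have := ae_foralln near_inv; apply: filterS => w hw.
apply: lee_gt_real => r sr; have [j hj] : exists j, j.+1%:R^-1 < r - s.
  exists (Num.truncn (r - s)^-1).
  rewrite -[ltRHS]invrK ltf_pV2 ?posrE ?invr_gt0 ?subr_gt0//.
  exact: truncnS_gt.
by apply: le_trans (hw j) _; rewrite lee_fin -lerBrDl ltW.
Qed.

Lemma range_lower_tail_near (r : R) : 0 < r -> (r%:E < r_inf P S)%E ->
  exists B : R, exists n0, forall n y, (n0 <= n)%N ->
  E n y (fun p => ((range_size (y :: p))%:R <= r * (n%:R / ln n%:R))%R%:R)
    <= B / root4 (ln n%:R) ^+ 3.
Proof.
move=> r0 rinf; have [c [C [c0 diag]]] := kernel_diag.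
have [D hD] := size_nbr_seq hdeg.
have [[y _]|noV] := pselect (exists y : V, True); last first.
  by exists 0, 0%N => n y; case: noV; exists y.
have fin : r_inf P S \is a fin_num by exact: r_inf_fin y.
move: rinf; rewrite -(fineK fin) lte_fin => rinf.
pose r2 := (r + fine (r_inf P S)) / 2.
have [rr2 r2i] : r < r2 /\ r2 < fine (r_inf P S) by rewrite /r2; split; lra.
have hesc : exists n0, forall n z, (n0 <= n)%N -> r2 <= ln n%:R * escape n z.
  by apply: r_inf_gt_near; rewrite -(fineK fin) lte_fin.
apply: (range_lower_le N_gt0 (@nbr_seq_uniq _ e) nbr_seq_sym hD c0 diag (r2 := r2)) => //.
by rewrite r0.
Qed.

Lemma probability_cvg0 x (A : nat -> set Omega) :
  (forall n, measurable (A n)) ->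
  (forall del : R, 0 < del ->
     exists n0, forall n, (n0 <= n)%N -> (P x (A n) <= del%:E)%E) ->
  P x (A n) @[n --> \oo] --> 0%E.
Proof.
move=> mA hA; apply/fine_cvgP; split.
  by apply: nearW => n; exact: fin_num_measure.
apply/cvgrPdist_le => del del0; have [n0 hn] := hA del del0.
exists n0 => // n n0n; rewrite /= sub0r normrN ger0_norm ?fine_ge0//.
by rewrite -lee_fin fineK ?fin_num_measure// hn.
Qed.

Lemma range_lower_prob x (eps : R) : 0 < eps ->
  P x [set w | (((walk_range S n w)%:R / scale R n)%:E
                  <= r_inf P S - eps%:E)%E] @[n --> \oo] --> 0%E.
Proof.
move=> eps0; have fin := r_inf_fin x; have := r_inf_ge0.
have rhoE := fineK fin; set rho := fine _ in rhoE.
rewrite -rhoE lee_fin => rho0.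
pose A n := [set w | (((walk_range S n w)%:R / scale R n)%:E <= rho%:E - eps%:E)%E].
apply: (@probability_cvg0 x A) => [n|del del0].
  have := measurable_trajectory hdeg hconn hwalk n
    [set s | (((range_size s)%:R / scale R n)%:E <= rho%:E - eps%:E)%E].
  by congr measurable; apply/seteqP; split => w; rewrite /A /mkset walk_rangeE.
have [rho_gt0|rho_le0] := ltP 0 rho; last first.
  exists 0%N => n _; rewrite (_ : A n = set0) ?measure0 ?lee_fin ?ltW//.
  apply/seteqP; split => // w; rewrite /A /= -EFinB lee_fin.
  by have := range_scale_ge0 n w; move: (_ / _) => q; lra.
(* The maximum makes [r] positive. *)
pose r := Num.max (rho / 2) (rho - eps).
have r0 : 0 < r by rewrite lt_max divr_gt0.
have rrho : r < rho by rewrite gt_max; apply/andP; split; lra.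
have [B [n0 hB]] : exists B : R, exists n0, forall n y, (n0 <= n)%N ->
  E n y (fun p => ((range_size (y :: p))%:R <= r * (n%:R / ln n%:R))%R%:R)
    <= B / root4 (ln n%:R) ^+ 3.
  by apply: range_lower_tail_near => //; rewrite -rhoE lte_fin.
have [n1 hn1] := scales_near (`|B| / del).
exists (maxn n0 (maxn n1 2)) => n; rewrite !geq_max => /and3P[n0n n1n n2].
have [_ _ hs s1 _] := hn1 n n1n.
apply: (@le_trans _ _ (P x [set w | (walk_range S n w)%:R <= r * (n%:R / ln n%:R)])).
  apply: le_measure; rewrite ?inE.
  - have := measurable_trajectory hdeg hconn hwalk n
      [set s | (((range_size s)%:R / scale R n)%:E <= rho%:E - eps%:E)%E].
    by congr measurable; apply/seteqP; split => w; rewrite /A /mkset walk_rangeE.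
  - exact: measurable_range_le.
  - move=> w; rewrite /A /= -EFinB lee_fin -range_scale_le// => /le_trans; apply.
    by rewrite le_max lexx orbT.
rewrite probability_range_le lee_fin; apply: le_trans (hB n x n0n) _.
have s0 : 0 < root4 (ln n%:R) ^+ 3 :> R by rewrite exprn_gt0// (lt_le_trans ltr01).
rewrite ler_pdivrMr//; apply: le_trans (ler_norm _) _.
move: hs; rewrite ler_pdivrMr// => /le_trans; apply.
by rewrite mulrC ler_wpM2l ?(ltW del0)// ler_eXnr.
Qed.

Lemma range_lower_as x (r : R) : 0 < r -> (r%:E < r_inf P S)%E ->
  \forall w \ae P x, exists n0, forall n, (n0 <= n)%N ->
    r / 2 * (n%:R / ln n%:R) <= (walk_range S n w)%:R.
Proof.
move=> r0 rinf; have fin := r_inf_fin x.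
have rhoE := fineK fin; set rho := fine _ in rhoE.
move: rinf; rewrite -rhoE lte_fin => rinf.
have [r1 [r2 [rr1 r12 r2i]]] : exists r1 r2 : R, [/\ r < r1, r1 < r2 & r2 < rho].
  exists (r + (rho - r) / 3), (r + (rho - r) / 3 * 2); split; lra.
have [B [n0 hB]] : exists B : R, exists n0, forall n y, (n0 <= n)%N ->
  E n y (fun p => ((range_size (y :: p))%:R <= r1 / 2 * (n%:R / ln n%:R))%R%:R)
    <= B / Num.sqrt (ln n%:R) ^+ 3.
  apply: (range_lower_half N_gt0 (r2 := r2)); first by rewrite r12 andbT; lra.
  by apply: range_lower_tail_near; [lra|rewrite -rhoE lte_fin].
(* The tail at time [n_k] is of order [k^(- 3 / 2)], as [ln n_k] is at least
   [del k / 2]. *)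
pose del := (r1 - r) / (2 * r1).
have del0 : 0 < del by rewrite divr_gt0 ?subr_gt0//; lra.
pose A k := [set w | (walk_range S (geo_time del k) w)%:R
  <= r1 / 2 * ((geo_time del k)%:R / ln (geo_time del k)%:R)].
have mA k : measurable (A k) by exact: measurable_range_le.
pose B' := `|B| / Num.sqrt (del / 2) ^+ 3.
have [k0 hk0] : exists k0, forall k, (k0 <= k)%N ->
   [/\ 2 / del <= k%:R :> R, (1 <= k)%N & (n0 <= geo_time del k)%N].
  exists (maxn 1 (Num.truncn (Num.max (2 / del) (2 * n0%:R / del))).+1) => k.
  rewrite geq_max => /andP[k1 hk].
  have : Num.max (2 / del) (2 * n0%:R / del) < k%:R.
    by apply: lt_le_trans (truncnS_gt _) _; rewrite ler_nat.
  rewrite gt_max => /andP[h1 h2]; split => //; first exact: ltW.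
  rewrite -(ler_nat R); apply: (@le_trans _ _ (ln (geo_time del k)%:R)).
    apply: le_trans (ln_geo_time_ge del0 (ltW h1)).
    by move: h2; rewrite ltr_pdivrMr//; lra.
  have [->|g0] := posnP (geo_time del k); first by rewrite ln0.
  by apply/ltW/ln_sublinear; rewrite ltr0n.
have PA k : (k0 <= k)%N -> (P x (A k) <= (B' / Num.sqrt k%:R ^+ 3)%:E)%E.
  move=> /hk0[k2 k1 gk]; rewrite probability_range_le lee_fin.
  apply: le_trans (hB _ x gk) _; have lk := ln_geo_time_ge del0 k2.
  have kR : 0 < k%:R :> R by rewrite ltr0n.
  have d20 : 0 < del / 2 by rewrite divr_gt0.
  rewrite /B' -mulrA -invfM -exprMn -sqrtrM ?(ltW d20)//.
  have sq0 : 0 < Num.sqrt (del / 2 * k%:R) ^+ 3.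
    by rewrite exprn_gt0// sqrtr_gt0 mulr_gt0.
  have sqle : Num.sqrt (del / 2 * k%:R) <= Num.sqrt (ln (geo_time del k)%:R).
    by rewrite ler_wsqrtr// mulrAC.
  apply: (@le_trans _ _ (`|B| / Num.sqrt (ln (geo_time del k)%:R) ^+ 3)).
    by rewrite ler_wpM2r ?ler_norm// invr_ge0 exprn_ge0// sqrtr_ge0.
  have sqle3 : Num.sqrt (del / 2 * k%:R) ^+ 3
      <= Num.sqrt (ln (geo_time del k)%:R) ^+ 3.
    by rewrite lerXn2r// nnegrE sqrtr_ge0.
  by rewrite ler_wpM2l// lef_pV2 ?posrE// (lt_le_trans sq0).
have := borel_cantelli_le mA PA; apply: filterS => w [k1 hw].
apply: (geo_interpolation (r := r / 2) (r' := r1 / 2) del0).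
- by apply/andP; split; lra.
- rewrite /del le_eqVlt; apply/orP; left; apply/eqP; field; lra.
- exact: walk_range_homo.
exists k1 => k hk; rewrite ltW// ltNge; apply/negP.
exact: hw.
Qed.

Lemma range_liminf x : \forall w \ae P x, (r_inf P S * (2^-1)%:E
  <= limn_einf (fun n => ((walk_range S n w)%:R / scale R n)%:E))%E.
Proof.
have fin := r_inf_fin x; have := r_inf_ge0.
have rhoE := fineK fin; set rho := fine _ in rhoE.
rewrite -rhoE lee_fin => rho0.
have [rho_gt0|rho_le0] := ltP 0 rho; last first.
  apply: aeW => w; apply: limn_einf_ge_near; exists 0%N => n _.
  rewrite -EFinM lee_fin (le_trans _ (range_scale_ge0 n w))//.
  by rewrite mulr_le0_ge0.
have below (j : nat) : \forall w \ae P x, exists n0, forall n, (n0 <= n)%N ->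
    rho * (1 - j.+2%:R^-1) / 2 * (n%:R / ln n%:R) <= (walk_range S n w)%:R.
  have j1 : j.+2%:R^-1 < 1 :> R by rewrite invf_lt1 ?ltr1n.
  apply: range_lower_as; first by rewrite mulr_gt0// subr_gt0.
  by rewrite -rhoE lte_fin gtr_pMr// gtrBl invr_gt0.
have := ae_foralln below; apply: filterS => w hw.
rewrite -EFinM; apply: lee_lt_real => t ht.
have [j hj] : exists j : nat, t <= rho * (1 - j.+2%:R^-1) / 2.
  have g0 : 0 < (rho / 2 - t) / (rho / 2) by rewrite !divr_gt0// subr_gt0.
  exists (Num.truncn ((rho / 2 - t) / (rho / 2))^-1).
  set k := Num.truncn _.
  have : k.+2%:R^-1 <= (rho / 2 - t) / (rho / 2).
    rewrite -[leRHS]invrK lef_pV2 ?posrE ?invr_gt0//.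
    by apply/ltW/(lt_trans (truncnS_gt _)); rewrite ltr_nat.
  rewrite ler_pdivlMr ?divr_gt0//; move: (k.+2%:R^-1) => q; lra.
have [n0 hn] := hw j.
apply: limn_einf_ge_near; exists (maxn n0 2) => n; rewrite geq_max => /andP[n0n n2].
by rewrite lee_fin (le_trans hj)// range_scale_ge// hn.
Qed.

End WalkRange.

Unset Implicit Arguments.
Set Strict Implicit.
Set Printing Implicit Defensive.

Theorem theorem1p3 (R : realType) (V : choiceType) (e : rel V)
    (hsimple : simple_graph e)
    (hinf : infinite_set [set: V])
    (hconn : connected_graph e)
    (hdeg : bounded_degree e)
    (d : measure_display) (Omega : measurableType d)
    (P : V -> probability Omega R) (S : nat -> Omega -> V)
    (hwalk : simple_random_walk e P S)
    (hrec : uniformly_weakly_recurrent P S)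
    (x : V) :
  [/\ \forall w \ae P x,
        (limn_esup (fun n => ((walk_range S n w)%:R / scale R n)%:E)
           <= r_sup P S)%E,
      forall eps : R, 0 < eps ->
        P x [set w | (((walk_range S n w)%:R / scale R n)%:E
                        <= r_inf P S - eps%:E)%E] @[n --> \oo] --> 0%E,
      \forall w \ae P x,
        (r_inf P S * (2^-1)%:E
           <= limn_einf (fun n => ((walk_range S n w)%:R / scale R n)%:E))%E &
      [/\ (r_inf P S
             <= limn_einf (fun n => 'E_(P x)[fun w => (walk_range S n w)%:R]
                                      * ((scale R n)^-1)%:E))%E,
          (limn_einf (fun n => 'E_(P x)[fun w => (walk_range S n w)%:R]
                                 * ((scale R n)^-1)%:E)
             <= limn_esup (fun n => 'E_(P x)[fun w => (walk_range S n w)%:R]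
                                      * ((scale R n)^-1)%:E))%E &
          (limn_esup (fun n => 'E_(P x)[fun w => (walk_range S n w)%:R]
                                 * ((scale R n)^-1)%:E)
             <= r_sup P S)%E]].
Proof.
split.
- exact: (range_limsup hinf hconn hdeg hwalk).
- exact: (range_lower_prob hsimple hinf hconn hdeg hwalk hrec).
- exact: (range_liminf hsimple hinf hconn hdeg hwalk hrec).
- split; last exact: (range_limsup_mean hinf hconn hdeg hwalk).
    exact: (range_liminf_mean hinf hconn hdeg hwalk hrec).
  exact: limn_einf_sup.
Qed.
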